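(* Let $r_c$ be a cavitating solution (that is, a solution with $r_c(0)>0$) of $$\frac{d}{dR}\left[R^{n-1}\hat\Phi_{,1}(r(R))\right]=(n-1)R^{n-2}\hat\Phi_{,2}(r(R)) \qquad (\ast)$$ satisfying $$\lim_{R\to0^+}\hat T(r(R))=0,\qquad(\ast\ast)$$ and assume that $\hat\Phi_{,1}(1,1,\dots,1)=0$. Then $r_c$ can be extended (as a solution of $(\ast)$) into $(0,\infty)$ with $$r_c'(R)<\frac{r_c(R)}{R},\qquad R\in(0,\infty).$$ Moreover, the function $r_c$ so extended is unique (does not depend on $r(1)$), and there exists $\lambda_c>1$ such that $$\lambda_c=\lim_{R\to\infty}r_c'(R)=\lim_{R\to\infty}\frac{r_c(R)}{R}.$$ If $r_\lambda$ is a solution of $(\ast)$ satisfying $(\ast\ast)$ and $r_\lambda(1)=\lambda$ with $\lambda>\lambda_c$, then $r_\lambda(R)=r_c(\alpha R)/\alpha$, where $\alpha$ is the unique solution of $r_c(\alpha)/\alpha=\lambda$.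
   Context: $n\in\{2,3\}$ is the space dimension and $\kappa>0$. The function $h:(0,\infty)\to[0,\infty)$ is a $C^1$ function that satisfies: $h''(d)>0$ for all $d>0$; $\lim_{d\to0^+}h(d)=\infty$; $\lim_{d\to\infty}h(d)/d=\infty$; $\lim_{d\to0^+}h'(d)=-\infty$; $\lim_{d\to\infty}h'(d)=\infty$. Modified stored energy: $$\hat\Phi(v_1,\dots,v_n)=\frac{\kappa}{n}v_1^n+h(v_1\cdots v_n)+\kappa v_1\cdots v_n\left(\frac{n-1}{n}+\ln(v_2\cdots v_n)\right).$$ $\hat\Phi_{,i}$ is the partial derivative with respect to the $i$-th argument and $\hat\Phi_{,i}(r(R))=\hat\Phi_{,i}\left(r'(R),\frac{r(R)}{R},\dots,\frac{r(R)}{R}\right)$. The modified radial Cauchy stress is $$\hat T(r(R))=\left[\frac{r(R)}{R}\right]^{1-n}\hat\Phi_{,1}(r(R)).$$ The equation $(\ast)$ is initially posed for $0<R<1$, for functions $r$ (the radial profile of the deformation $\mathbf{x}\mapsto r(R)\mathbf{x}/R$ of the unit ball, $R=\|\mathbf{x}\|$) with $r'(R)>0$ and $r(R)/R>0$.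
   Formalization: Literal uniqueness of the extended r_c fails, since r_c(αR)/α is again a cavitating solution satisfying (∗∗); stated instead: the extension of a given r_c is unique, and any two cavitating solutions on (0,∞) satisfying (∗∗) agree up to this scaling. *)

(* Defs.v *)
From Stdlib Require Import Reals ZArith.
From Coquelicot Require Import Coquelicot.

Open Scope R_scope.

(* An argument list (v_1, ..., v_n) is a function v : nat -> R of which only
   the values v 1, ..., v n are used.  A function of the open half-line is
   represented by a total function R -> R whose values at nonpositive
   arguments are irrelevant. *)

Definition partial (i : nat) (F : (nat -> R) -> R) (v : nat -> R) : R :=
  Derive (fun t => F (fun j => if Nat.eqb j i then t else v j)) (v i).

(* v_1 * ... * v_n and v_2 * ... * v_n, for n >= 2:
   [prod_f_R0 f N] is f 0 * ... * f N. *)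
Definition prod_all (n : nat) (v : nat -> R) : R :=
  prod_f_R0 (fun k => v (k + 1)%nat) (n - 1).
Definition prod_tail (n : nat) (v : nat -> R) : R :=
  prod_f_R0 (fun k => v (k + 2)%nat) (n - 2).

Record compressibility (h : R -> R) : Prop := {
  h_nonneg : forall d, 0 < d -> 0 <= h d;
  h_C1 : forall d, 0 < d -> ex_derive h d /\ continuous (Derive h) d;
  h_convex : forall d, 0 < d -> ex_derive_n h 2 d /\ 0 < Derive_n h 2 d;
  h_at_0 : filterlim h (at_right 0) (Rbar_locally p_infty);
  h_superlinear : is_lim (fun d => h d / d) p_infty p_infty;
  h'_at_0 : filterlim (Derive h) (at_right 0) (Rbar_locally m_infty);
  h'_at_infty : is_lim (Derive h) p_infty p_infty
}.

Definition Phi (n : nat) (kappa : R) (h : R -> R) (v : nat -> R) : R :=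
  kappa / INR n * v 1%nat ^ n + h (prod_all n v)
  + kappa * prod_all n v * ((INR n - 1) / INR n + ln (prod_tail n v)).

Definition radial_stretches (r : R -> R) (x : R) : nat -> R :=
  fun i => if Nat.eqb i 1 then Derive r x else r x / x.

Definition Phi_d (n : nat) (kappa : R) (h : R -> R) (i : nat)
    (r : R -> R) (x : R) : R :=
  partial i (Phi n kappa h) (radial_stretches r x).

Definition cauchy_stress (n : nat) (kappa : R) (h : R -> R)
    (r : R -> R) (x : R) : R :=
  powerRZ (r x / x) (1 - Z.of_nat n) * Phi_d n kappa h 1 r x.

(* Solution of the radial equilibrium equation on the interval (0, b). *)
Definition radial_solution (n : nat) (kappa : R) (h : R -> R) (b : Rbar)
    (r : R -> R) : Prop :=
  forall x : R, 0 < x -> Rbar_lt x b ->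
    ex_derive r x /\ 0 < Derive r x /\ 0 < r x / x /\
    is_derive (fun y => y ^ (n - 1) * Phi_d n kappa h 1 r y) x
      ((INR n - 1) * x ^ (n - 2) * Phi_d n kappa h 2 r x).

(* r(0) > 0, where r(0) is the limit of r at 0 from the right. *)
Definition cavitating (r : R -> R) : Prop :=
  exists r0 : R, 0 < r0 /\ filterlim r (at_right 0) (locally r0).

Definition stress_free_cavity (n : nat) (kappa : R) (h : R -> R)
    (r : R -> R) : Prop :=
  filterlim (cauchy_stress n kappa h r) (at_right 0) (locally 0).

(* Main.v *)
Require Import Defs.
From Stdlib Require Import Reals ZArith Lra Lia Classical ClassicalEpsilon.
From Coquelicot Require Import Coquelicot.

Open Scope R_scope.

(* In the variables s = ln R, w = ln (r / R), t = R r' / r, the stress divided by kappa is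
   T = t^m + k (t e^{(m+1) w}) + m w with m = n - 1 and k = h' / kappa + (n-1)/n, and the
   equation becomes the autonomous system w' = t - 1, T' = m t (1 - t^m).  Dilations of r
   are translations of s.  The vector field, as a function of (w, T) with t kept in [a, 1],
   is Lipschitz although h'' need not be continuous: t is bounded below along forward orbits,
   which gives global continuation and forward uniqueness.  Since t' = (positive) (1 - t),
   the sign of 1 - t is constant; a stress-free cavity forces t < 1, and conversely a stress-free
   solution with t < 1 has w -> oo and t -> 0 at s = -oo.  The stress-free
   trajectory is unique: as graphs T(w) with T' = - m (t + ... + t^m) and T -> 0 at
   w = oo, two trajectories with T1 - T2 = D > 0 at some w can be compared after translating
   the first by 2 D / m, and this bounds D by 4 D t.  Finally T > 0 keeps w above a positive
   number, so w converges to a positive limit ln lambda_c and t to 1. *)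

(** * Real analysis *)

(** The second derivative of [h] is only known to exist and to be positive, with no local bound, so
    Picard iteration does not apply to the system in [(w, t)], whose field contains [h'']. With the
    stress as second unknown, the field only needs [t] as a function of [(w, T)]; this implicit
    function is Lipschitz because [k] is increasing, with a constant that owes nothing to [k'].
    Later estimates likewise use the sign of [k'], and where its size enters, it enters numerator
    and denominator of one quotient. The Lipschitz constant is of order [1 / a], where [a] bounds
    [t] from below, and it blows up towards the cavity, where [t] tends to 0. The cavity trajectory
    is therefore not accessible as the solution of an initial value problem at [s = -oo], and its
    uniqueness needs the separate argument on graphs. The points with [t = 1] are equilibria, one
    for each [w]: the homogeneous deformations. Uniqueness keeps a trajectory from reaching one in
    finite time, and [w = ln lambda_c] is the one approached. *)

Lemma mvt (f df : R -> R) (a b : R) :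
  a < b -> (forall x, a <= x <= b -> is_derive f x (df x)) ->
  exists c, a < c < b /\ f b - f a = df c * (b - a).
Proof.
intros Hab Hd.
destruct (MVT_cor2 f df a b Hab) as [c [Hc1 Hc2]].
- intros c Hc. apply is_derive_Reals. now apply Hd.
- now exists c.
Qed.

Lemma derive_nonneg_le (f df : R -> R) (a b : R) :
  a <= b -> (forall x, a <= x <= b -> is_derive f x (df x)) ->
  (forall x, a <= x <= b -> 0 <= df x) -> f a <= f b.
Proof.
intros Hab Hd Hp. destruct (Req_dec a b) as [->|Hn]; [lra|].
destruct (mvt f df a b) as [c [Hc He]]; [lra|assumption|].
assert (0 <= df c) by (apply Hp; lra). nra.
Qed.

Lemma derive_pos_lt (f df : R -> R) (a b : R) :
  a < b -> (forall x, a <= x <= b -> is_derive f x (df x)) ->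
  (forall x, a <= x <= b -> 0 < df x) -> f a < f b.
Proof.
intros Hab Hd Hp.
destruct (mvt f df a b) as [c [Hc He]]; [lra|assumption|].
assert (0 < df c) by (apply Hp; lra). nra.
Qed.

Lemma continuous_eps (f : R -> R) (x : R) :
  continuous f x <->
  forall eps, 0 < eps -> exists delta, 0 < delta /\
    forall y, Rabs (y - x) < delta -> Rabs (f y - f x) < eps.
Proof.
split.
- intros Hc eps Heps.
  destruct (Hc (ball (f x) (mkposreal eps Heps)) (locally_ball _ _)) as [d Hd].
  exists d; split; [apply cond_pos|]. intros y Hy. exact (Hd y Hy).
- intros H P [e He]. destruct (H e (cond_pos e)) as [d [Hd Hy]].
  exists (mkposreal d Hd). intros y Hb. apply He. exact (Hy y Hb).
Qed.

Lemma is_derive_continuous (f : R -> R) (x l : R) : is_derive f x l -> continuous f x.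
Proof. intros H. apply (ex_derive_continuous f). now exists l. Qed.

(** The difference quotient, completed by [l] at [x], is continuous at [x]. Such quotients turn the
    differentiation of inverse and implicit functions into algebra at a single point, which suits a
    [k] whose derivative may be discontinuous. *)
Lemma caratheodory (f : R -> R) (x l : R) :
  is_derive f x l ->
  exists phi, (forall y, f y - f x = phi y * (y - x)) /\ continuous phi x /\ phi x = l.
Proof.
intros Hd. apply is_derive_Reals in Hd.
exists (fun y => if Req_EM_T y x then l else (f y - f x) / (y - x)).
repeat split.
- intros y. destruct (Req_EM_T y x) as [->|Hn]; [ring|]. field. lra.
- apply continuous_eps. intros eps He. destruct (Hd eps He) as [d Hd'].
  exists d; split; [apply cond_pos|]. intros y Hy.
  destruct (Req_EM_T x x) as [_|]; [|lra].
  destruct (Req_EM_T y x) as [->|Hn].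
  + now rewrite Rminus_diag, Rabs_R0.
  + specialize (Hd' (y - x)). replace (x + (y - x)) with y in Hd' by ring.
    apply Hd'; [lra|assumption].
- destruct (Req_EM_T x x); lra.
Qed.

Lemma caratheodory_derive (f phi : R -> R) (x : R) :
  locally x (fun y => f y - f x = phi y * (y - x)) -> continuous phi x ->
  is_derive f x (phi x).
Proof.
intros [d1 H1] Hc. apply is_derive_Reals. intros eps He.
destruct (proj1 (continuous_eps phi x) Hc eps He) as [d2 [Hd2 H2]].
assert (Hm : 0 < Rmin d1 d2) by (apply Rmin_glb_lt; [apply cond_pos|assumption]).
exists (mkposreal _ Hm). simpl. intros h Hh Hhd.
assert (Ha : Rabs (x + h - x) < Rmin d1 d2) by (now replace (x + h - x) with h by ring).
assert (E : f (x + h) - f x = phi (x + h) * (x + h - x)).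
{ apply H1. apply Rlt_le_trans with (1 := Ha). apply Rmin_l. }
rewrite E. replace (phi (x + h) * (x + h - x) / h) with (phi (x + h)) by (field; assumption).
apply H2. apply Rlt_le_trans with (1 := Ha). apply Rmin_r.
Qed.

(** Dividing [y - x = phi (g y) * (g y - g x)] by [phi (g y)] exhibits [/ phi (g y)] as the
    Caratheodory quotient of [g]. *)
Lemma derive_inverse (f g : R -> R) (x l : R) :
  locally x (fun y => f (g y) = y) -> continuous g x -> is_derive f (g x) l -> l <> 0 ->
  is_derive g x (/ l).
Proof.
intros Hfg Hg Hf Hl. destruct (caratheodory _ _ _ Hf) as [phi [Hphi [Hc He]]].
assert (Hx := locally_singleton _ _ Hfg). simpl in Hx.
assert (K : continuous (fun y => / phi (g y)) x).
{ apply continuous_comp with (f := fun y => phi (g y)) (g := Rinv).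
  - now apply continuous_comp.
  - apply continuous_Rinv. now rewrite He. }
rewrite <- He. apply (caratheodory_derive g (fun y => / phi (g y)) x); [|exact K].
revert Hfg. apply filter_imp. intros y Hy.
specialize (Hphi (g y)). rewrite Hy, Hx in Hphi.
(* A zero of [phi (g y)] forces [y = x], and then both sides vanish, whatever the value of the
   inverse of 0. *)
destruct (Req_dec (phi (g y)) 0) as [H0|H0].
- rewrite H0 in Hphi. assert (y = x) by lra. subst y. ring.
- rewrite Hphi. field. assumption.
Qed.

Lemma IVT_interval (f : R -> R) (a b v : R) :
  a <= b -> (forall x, a <= x <= b -> continuous f x) -> Rmin (f a) (f b) <= v <= Rmax (f a) (f b) ->
  exists c, a <= c <= b /\ f c = v.
Proof.
intros Hab Hc Hv.
(* Extending [f] by its endpoint values makes it continuous everywhere. *)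
set (g x := f (Rmax a (Rmin b x))).
assert (Hcl : forall x, a <= Rmax a (Rmin b x) <= b).
{ intros x. split; [apply Rmax_l|]. apply Rmax_lub; [assumption|apply Rmin_l]. }
assert (Hid : forall x, a <= x <= b -> Rmax a (Rmin b x) = x).
{ intros x Hx. rewrite Rmin_right, Rmax_right; lra. }
assert (Hg : forall x, continuity_pt g x).
{ intros x. apply continuity_pt_filterlim. apply continuous_eps. intros eps He.
  destruct (proj1 (continuous_eps f _) (Hc _ (Hcl x)) eps He) as [d [Hd H]].
  exists d; split; [assumption|]. intros y Hy. apply H.
  apply Rle_lt_trans with (2 := Hy). unfold Rmax, Rmin.
  repeat (destruct Rle_dec); unfold Rabs; repeat destruct Rcase_abs; lra. }
destruct (IVT_gen g a b v Hg) as [c [Hc1 Hc2]].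
- unfold g. now rewrite !Hid by lra.
- rewrite Rmin_left, Rmax_right in Hc1 by lra. exists c. split; [assumption|].
  unfold g in Hc2. now rewrite Hid in Hc2.
Qed.

(** After the last point [c] of [[a, b]] where [y <= v], the function exceeds [v], so its slope is
    nonpositive there; the mean value theorem on [[c, b]] then contradicts [v < y b]. *)
Lemma barrier (y dy : R -> R) (a b v : R) :
  a <= b -> (forall x, a <= x <= b -> is_derive y x (dy x)) ->
  (forall x, a <= x <= b -> v <= y x -> dy x <= 0) -> y a <= v -> y b <= v.
Proof.
intros Hab Hd Hs Ha. destruct (Rle_lt_dec (y b) v) as [|Hb]; [assumption|exfalso].
destruct (completeness (fun x => a <= x <= b /\ y x <= v)) as [c [Hub Hlub]].
- exists b. intros x Hx. apply Hx.
- exists a. lra.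
- assert (Hac : a <= c) by (apply Hub; lra).
  assert (Hcb : c <= b) by (apply Hlub; intros x Hx; apply Hx).
  assert (Hcont := is_derive_continuous _ _ _ (Hd c (conj Hac Hcb))).
  assert (Hyc : y c <= v).
  { destruct (Rle_lt_dec (y c) v) as [|Hlt]; [assumption|exfalso].
    destruct (proj1 (continuous_eps y c) Hcont (y c - v)) as [d [Hd0 Hnear]]; [lra|].
    assert (c <= c - d); [|lra]. apply Hlub. intros x [Hx1 Hx2].
    assert (x <= c) by (apply Hub; tauto).
    destruct (Rle_lt_dec x (c - d)) as [|Hlt2]; [assumption|exfalso].
    assert (Hxd : Rabs (x - c) < d) by (apply Rabs_def1; lra).
    specialize (Hnear x Hxd). apply Rabs_def2 in Hnear. lra. }
  assert (Hlt : c < b) by (destruct (Req_dec c b); [subst; lra|lra]).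
  destruct (mvt y dy c b Hlt) as [x [Hx He]]; [intros; apply Hd; lra|].
  assert (Hyx : v < y x).
  { destruct (Rle_lt_dec (y x) v); [|assumption].
    assert (x <= c) by (apply Hub; split; lra). lra. }
  assert (dy x <= 0) by (apply Hs; lra). nra.
Qed.

Lemma derive_le_le (u v du dv : R -> R) (a b : R) :
  a <= b -> (forall s, a <= s <= b -> is_derive u s (du s)) ->
  (forall s, a <= s <= b -> is_derive v s (dv s)) ->
  (forall s, a <= s <= b -> du s <= dv s) -> u b - u a <= v b - v a.
Proof.
intros Hab Hu Hv Hle.
assert (v a - u a <= v b - u b); [|lra].
apply (derive_nonneg_le (fun s => v s - u s) (fun s => dv s - du s)); [assumption| |].
- intros s Hs. apply (is_derive_minus (K := R_AbsRing) v u); auto.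
- intros s Hs. specialize (Hle s Hs). lra.
Qed.

Lemma derive_abs_le (u v du dv : R -> R) (a b : R) :
  a <= b -> (forall s, a <= s <= b -> is_derive u s (du s)) ->
  (forall s, a <= s <= b -> is_derive v s (dv s)) ->
  (forall s, a <= s <= b -> Rabs (du s) <= dv s) -> Rabs (u b - u a) <= v b - v a.
Proof.
intros Hab Hu Hv Hle. apply Rabs_le. split.
- assert (H : (fun s => - u s) b - (fun s => - u s) a <= v b - v a); [|simpl in H; lra].
  apply (derive_le_le (fun s => - u s) v (fun s => - du s) dv); auto.
  + intros s Hs. apply (is_derive_opp (K := R_AbsRing) u). auto.
  + intros s Hs. specialize (Hle s Hs). apply Rabs_le_between in Hle. lra.
- apply (derive_le_le u v du dv); auto.
  intros s Hs. specialize (Hle s Hs). apply Rabs_le_between in Hle. lra.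
Qed.

Lemma half_pow_small (A eps : R) : 0 < eps -> exists j, forall i, (j <= i)%nat -> A * (/ 2) ^ i < eps.
Proof.
intros He. destruct (Rle_lt_dec A 0) as [HA|HA].
- exists O. intros i _. assert (0 < (/ 2) ^ i) by (apply pow_lt; lra). nra.
- assert (H2 : Rabs (/ 2) < 1) by (rewrite Rabs_pos_eq; lra).
  destruct (pow_lt_1_zero (/ 2) H2 (eps / A)) as [j Hj]; [now apply Rdiv_lt_0_compat|].
  exists j. intros i Hi. specialize (Hj i Hi). rewrite Rabs_pos_eq in Hj by (apply pow_le; lra).
  apply (Rmult_lt_compat_l A) in Hj; [|assumption].
  replace (A * (eps / A)) with eps in Hj by (field; lra). assumption.
Qed.

Lemma geometric_limit (u : nat -> R) (A : R) :
  (forall j, Rabs (u (S j) - u j) <= A * (/ 2) ^ j) ->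
  exists l, forall j, Rabs (l - u j) <= 2 * A * (/ 2) ^ j.
Proof.
intros Hu.
(* The factor [1 - (/ 2) ^ p] is the exact partial geometric sum, which lets the induction on [p]
   close; it is bounded by 1 afterwards. *)
assert (Hp : forall j p, Rabs (u (p + j)%nat - u j) <= 2 * A * (/ 2) ^ j * (1 - (/ 2) ^ p)).
{ intros j p. induction p as [|p IH].
  - simpl. rewrite Rminus_diag, Rabs_R0. lra.
  - replace (u (S p + j)%nat - u j) with ((u (S (p + j)) - u (p + j)%nat) + (u (p + j)%nat - u j)) by (simpl; ring).
    apply Rle_trans with (1 := Rabs_triang _ _). specialize (Hu (p + j)%nat).
    rewrite pow_add in Hu. simpl pow. lra. }
assert (HA : 0 <= A) by (generalize (Hu O) (Rabs_pos (u 1%nat - u O)); simpl; lra).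
assert (Hle : forall j i, (j <= i)%nat -> Rabs (u i - u j) <= 2 * A * (/ 2) ^ j).
{ intros j i Hij. replace i with ((i - j) + j)%nat by lia.
  apply Rle_trans with (1 := Hp _ _). rewrite <- Rmult_1_r. apply Rmult_le_compat_l.
  - apply Rmult_le_pos; [lra|]. apply pow_le; lra.
  - assert (0 < (/ 2) ^ (i - j)) by (apply pow_lt; lra). lra. }
destruct (Rcomplete.R_complete u) as [l Hl].
- intros eps He. destruct (half_pow_small (2 * A) (eps / 2)) as [N HN]; [lra|].
  exists N. intros i i' Hi Hi'. unfold Rdist.
  replace (u i - u i') with ((u i - u N) - (u i' - u N)) by ring.
  unfold Rminus at 1. apply Rle_lt_trans with (1 := Rabs_triang _ _). rewrite Rabs_Ropp.
  generalize (Hle N i Hi) (Hle N i' Hi') (HN N (le_n N)). lra.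
- exists l. intros j. apply Rnot_lt_le. intros Hlt.
  destruct (Hl (Rabs (l - u j) - 2 * A * (/ 2) ^ j)) as [N HN]; [lra|].
  specialize (HN (max N j)). unfold Rdist in HN.
  assert (K1 := HN (Nat.le_max_l _ _)). assert (K2 := Hle j _ (Nat.le_max_r N j)).
  assert (K3 := Rabs_triang (l - u (max N j)) (u (max N j) - u j)).
  replace (l - u (max N j) + (u (max N j) - u j)) with (l - u j) in K3 by ring.
  rewrite (Rabs_minus_sym l (u (max N j))) in K3. lra.
Qed.

(** * Picard iteration for a bounded Lipschitz planar system on [s >= 0] *)

Section Picard.

Variables (f g : R -> R -> R) (L B : R).
Hypothesis L_pos : 0 < L.
Hypothesis f_lipschitz : forall x1 y1 x2 y2,
  Rabs (f x1 y1 - f x2 y2) <= L * (Rabs (x1 - x2) + Rabs (y1 - y2)).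
Hypothesis g_lipschitz : forall x1 y1 x2 y2,
  Rabs (g x1 y1 - g x2 y2) <= L * (Rabs (x1 - x2) + Rabs (y1 - y2)).
Hypothesis f_bounded : forall x y, Rabs (f x y) <= B.
Hypothesis g_bounded : forall x y, Rabs (g x y) <= B.
Variables x0 y0 : R.

Fixpoint picard (j : nat) : (R -> R) * (R -> R) :=
  match j with
  | O => (fun _ => x0, fun _ => y0)
  | S i => (fun s => x0 + RInt (fun u => f (fst (picard i) u) (snd (picard i) u)) 0 s,
            fun s => y0 + RInt (fun u => g (fst (picard i) u) (snd (picard i) u)) 0 s)
  end.

Lemma lipschitz_comp_continuous (F : R -> R -> R) :
  (forall x1 y1 x2 y2, Rabs (F x1 y1 - F x2 y2) <= L * (Rabs (x1 - x2) + Rabs (y1 - y2))) ->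
  forall (x y : R -> R) s, continuous x s -> continuous y s -> continuous (fun u => F (x u) (y u)) s.
Proof.
intros HF x y s Hx Hy. apply continuous_eps. intros eps He.
assert (He' : 0 < eps / (2 * L)) by (apply Rdiv_lt_0_compat; lra).
destruct (proj1 (continuous_eps x s) Hx _ He') as [d1 [Hd1 H1]].
destruct (proj1 (continuous_eps y s) Hy _ He') as [d2 [Hd2 H2]].
exists (Rmin d1 d2). split; [now apply Rmin_glb_lt|]. intros u Hu.
assert (K1 := H1 u (Rlt_le_trans _ _ _ Hu (Rmin_l _ _))).
assert (K2 := H2 u (Rlt_le_trans _ _ _ Hu (Rmin_r _ _))).
apply Rle_lt_trans with (1 := HF _ _ _ _).
replace eps with (L * (eps / (2 * L) + eps / (2 * L))) by (field; lra).
apply Rmult_lt_compat_l; lra.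
Qed.

Lemma derive_primitive (F : R -> R) (c : R) :
  (forall s, continuous F s) -> forall s, is_derive (fun s => c + RInt F 0 s) s (F s).
Proof.
intros HF s. rewrite <- (Rplus_0_l (F s)).
apply (is_derive_plus (K := R_AbsRing) (V := R_NormedModule) (fun _ => c) (fun s => RInt F 0 s)).
- exact (is_derive_const c s).
- apply (is_derive_RInt F (fun s => RInt F 0 s) 0 s).
  + apply filter_forall. intros b. apply (RInt_correct (V := R_CompleteNormedModule)).
    apply (ex_RInt_continuous (V := R_CompleteNormedModule)). intros; apply HF.
  + apply HF.
Qed.

Lemma picard_continuous (j : nat) :
  (forall s, continuous (fst (picard j)) s) /\ (forall s, continuous (snd (picard j)) s).
Proof.
induction j as [|j [IH1 IH2]]; simpl.
- split; intros s; apply continuous_const.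
- split; intros s; eapply is_derive_continuous.
  + apply (derive_primitive (fun u => f (fst (picard j) u) (snd (picard j) u))).
    intros u. now apply lipschitz_comp_continuous.
  + apply (derive_primitive (fun u => g (fst (picard j) u) (snd (picard j) u))).
    intros u. now apply lipschitz_comp_continuous.
Qed.

Lemma picard_derive (j : nat) (s : R) :
  is_derive (fst (picard (S j))) s (f (fst (picard j) s) (snd (picard j) s)) /\
  is_derive (snd (picard (S j))) s (g (fst (picard j) s) (snd (picard j) s)).
Proof.
destruct (picard_continuous j) as [H1 H2].
split; simpl.
- apply (derive_primitive (fun u => f (fst (picard j) u) (snd (picard j) u))).
  intros u. now apply lipschitz_comp_continuous.
- apply (derive_primitive (fun u => g (fst (picard j) u) (snd (picard j) u))).
  intros u. now apply lipschitz_comp_continuous.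
Qed.

Lemma picard_init (j : nat) : fst (picard j) 0 = x0 /\ snd (picard j) 0 = y0.
Proof.
destruct j; simpl; [tauto|].
assert (E : forall F : R -> R, RInt F 0 0 = 0) by (intros F; apply (RInt_point 0 F)).
rewrite !E. split; ring.
Qed.

(* With the weight [exp (4 L s)] the Picard operator contracts by the factor 1/2. *)
Lemma weighted_contraction (z1 z2 dz1 dz2 : R -> R) (C s : R) :
  0 <= C -> 0 <= s -> z1 0 = z2 0 ->
  (forall u, 0 <= u <= s -> is_derive z1 u (dz1 u)) ->
  (forall u, 0 <= u <= s -> is_derive z2 u (dz2 u)) ->
  (forall u, 0 <= u <= s -> Rabs (dz1 u - dz2 u) <= 2 * L * C * exp (4 * L * u)) ->
  Rabs (z1 s - z2 s) <= C / 2 * exp (4 * L * s).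
Proof.
intros HC Hs H0 D1 D2 Hb.
assert (K : Rabs ((fun u => z1 u - z2 u) s - (fun u => z1 u - z2 u) 0)
  <= C / 2 * exp (4 * L * s) - C / 2 * exp (4 * L * 0)).
{ apply (derive_abs_le (fun u => z1 u - z2 u) (fun u => C / 2 * exp (4 * L * u))
    (fun u => dz1 u - dz2 u) (fun u => 2 * L * C * exp (4 * L * u)) 0 s Hs).
  - intros u Hu. apply (is_derive_minus (K := R_AbsRing) z1 z2); auto.
  - intros u _. auto_derive; [trivial|]. field.
  - exact Hb. }
simpl in K. rewrite H0, Rminus_diag, Rminus_0_r in K.
assert (0 < exp (4 * L * 0)) by apply exp_pos. nra.
Qed.

Lemma bound_nonneg : 0 <= B.
Proof. generalize (f_bounded 0 0) (Rabs_pos (f 0 0)). lra. Qed.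

Lemma picard_step (j : nat) (s : R) : 0 <= s ->
  Rabs (fst (picard (S j)) s - fst (picard j) s) <= B / L * exp (4 * L * s) * (/ 2) ^ j /\
  Rabs (snd (picard (S j)) s - snd (picard j) s) <= B / L * exp (4 * L * s) * (/ 2) ^ j.
Proof.
assert (HB0 := bound_nonneg).
assert (HBL : 0 <= B / L) by (apply Rdiv_le_0_compat; lra).
revert s. induction j as [|j IH]; intros s Hs.
(* The first increment fits the contraction scheme with [C = B / L]: the bound [B] on the field is
   at most [2 * L * C = 2 * B] times a weight that is at least 1. *)
- assert (Hw : forall (F : R -> R -> R) (p q : R), Rabs (F p q) <= B ->
    forall u, 0 <= u <= s -> Rabs (F p q - 0) <= 2 * L * (B / L) * exp (4 * L * u)).
  { intros F p q HF u Hu. rewrite Rminus_0_r. replace (2 * L * (B / L)) with (2 * B) by (field; lra).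
    assert (1 <= exp (4 * L * u)).
    { apply Rle_trans with (1 + 4 * L * u); [nra|]. apply exp_ineq1_le. }
    nra. }
  assert (0 < exp (4 * L * s)) by apply exp_pos.
  destruct (picard_init 1) as [E1 E2].
  assert (B / L / 2 * exp (4 * L * s) <= B / L * exp (4 * L * s) * (/ 2) ^ 0) by (simpl; nra).
  split; (eapply Rle_trans; [|eassumption]).
  + apply (weighted_contraction (fst (picard 1)) (fst (picard 0)) (fun _ => f x0 y0) (fun _ => 0) (B / L) s); auto.
    * intros u _. exact (proj1 (picard_derive 0 u)).
    * intros u _. exact (is_derive_const x0 u).
  + apply (weighted_contraction (snd (picard 1)) (snd (picard 0)) (fun _ => g x0 y0) (fun _ => 0) (B / L) s); auto.
    * intros u _. exact (proj2 (picard_derive 0 u)).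
    * intros u _. exact (is_derive_const y0 u).
- assert (HC : 0 <= B / L * (/ 2) ^ j) by (apply Rmult_le_pos; [assumption|apply pow_le; lra]).
  assert (Hw : forall F : R -> R -> R, (forall x1 y1 x2 y2,
      Rabs (F x1 y1 - F x2 y2) <= L * (Rabs (x1 - x2) + Rabs (y1 - y2))) ->
    forall u, 0 <= u <= s -> Rabs (F (fst (picard (S j)) u) (snd (picard (S j)) u)
      - F (fst (picard j) u) (snd (picard j) u)) <= 2 * L * (B / L * (/ 2) ^ j) * exp (4 * L * u)).
  { intros F HF u Hu. apply Rle_trans with (1 := HF _ _ _ _).
    destruct (IH u (proj1 Hu)) as [K1 K2].
    replace (2 * L * (B / L * (/ 2) ^ j) * exp (4 * L * u)) with
      (L * (B / L * exp (4 * L * u) * (/ 2) ^ j + B / L * exp (4 * L * u) * (/ 2) ^ j)) by ring.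
    apply Rmult_le_compat_l; lra. }
  destruct (picard_init (S (S j))) as [E1 E2]. destruct (picard_init (S j)) as [E3 E4].
  replace (B / L * exp (4 * L * s) * (/ 2) ^ S j) with (B / L * (/ 2) ^ j / 2 * exp (4 * L * s))
    by (simpl; field; lra).
  split.
  + apply (weighted_contraction (fst (picard (S (S j)))) (fst (picard (S j)))
      (fun u => f (fst (picard (S j)) u) (snd (picard (S j)) u))
      (fun u => f (fst (picard j) u) (snd (picard j) u)) _ s); auto; try congruence.
    * intros u _. apply picard_derive.
    * intros u _. apply picard_derive.
  + apply (weighted_contraction (snd (picard (S (S j)))) (snd (picard (S j)))
      (fun u => g (fst (picard (S j)) u) (snd (picard (S j)) u))
      (fun u => g (fst (picard j) u) (snd (picard j) u)) _ s); auto; try congruence.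
    * intros u _. apply picard_derive.
    * intros u _. apply picard_derive.
Qed.

(** A Lipschitz constant independent of [j] passes to the pointwise limit; this is how the limit of
    the iterates becomes continuous, hence integrable. *)
Lemma picard_lipschitz (j : nat) (s u : R) :
  Rabs (fst (picard j) s - fst (picard j) u) <= B * Rabs (s - u) /\
  Rabs (snd (picard j) s - snd (picard j) u) <= B * Rabs (s - u).
Proof.
assert (HB0 := bound_nonneg).
assert (Hmain : forall s u, u <= s ->
  Rabs (fst (picard j) s - fst (picard j) u) <= B * (s - u) /\
  Rabs (snd (picard j) s - snd (picard j) u) <= B * (s - u)).
{ intros s' u' Hle. destruct j as [|j].
  - simpl. rewrite !Rminus_diag, Rabs_R0. split; nra.
  - replace (B * (s' - u')) with ((fun v => B * v) s' - (fun v => B * v) u') by ring.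
    assert (HD : forall v, is_derive (fun v => B * v) v B) by (intros v; auto_derive; [trivial|ring]).
    split.
    + apply (derive_abs_le _ _ _ (fun _ => B) u' s' Hle (fun v _ => proj1 (picard_derive j v))); auto.
    + apply (derive_abs_le _ _ _ (fun _ => B) u' s' Hle (fun v _ => proj2 (picard_derive j v))); auto. }
destruct (Rle_lt_dec u s) as [H|H].
- rewrite (Rabs_pos_eq (s - u)) by lra. now apply Hmain.
- rewrite (Rabs_minus_sym s u), (Rabs_pos_eq (u - s)) by lra.
  rewrite (Rabs_minus_sym (fst _ s)), (Rabs_minus_sym (snd _ s)). apply Hmain. lra.
Qed.

Lemma planar_ode_exists :
  exists x y : R -> R, x 0 = x0 /\ y 0 = y0 /\ forall s, 0 <= s ->
    is_derive x s (f (x s) (y s)) /\ is_derive y s (g (x s) (y s)).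
Proof.
set (A s := 2 * (B / L * exp (4 * L * s))).
assert (HX : forall s, exists l, 0 <= s -> forall j, Rabs (l - fst (picard j) s) <= A s * (/ 2) ^ j).
{ intros s. destruct (Rle_lt_dec 0 s) as [Hs|Hs]; [|exists 0; lra].
  destruct (geometric_limit (fun j => fst (picard j) s) _ (fun j => proj1 (picard_step j s Hs))) as [l Hl].
  now exists l. }
assert (HY : forall s, exists l, 0 <= s -> forall j, Rabs (l - snd (picard j) s) <= A s * (/ 2) ^ j).
{ intros s. destruct (Rle_lt_dec 0 s) as [Hs|Hs]; [|exists 0; lra].
  destruct (geometric_limit (fun j => snd (picard j) s) _ (fun j => proj2 (picard_step j s Hs))) as [l Hl].
  now exists l. }
destruct (choice _ HX) as [X HXl]. destruct (choice _ HY) as [Y HYl].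
assert (HB0 := bound_nonneg).
(* The iterates are controlled for [s >= 0] only. Composing the limits with [Rmax 0] freezes them at
   negative arguments, so that they are continuous on the whole line and primitives have two-sided
   derivatives at 0. *)
assert (Hcl : forall s u, Rabs (Rmax 0 s - Rmax 0 u) <= Rabs (s - u)).
{ intros s u. unfold Rmax. repeat destruct Rle_dec; unfold Rabs; repeat destruct Rcase_abs; lra. }
assert (Hpos : forall s, 0 <= Rmax 0 s) by (intros; apply Rmax_l).
assert (Hlip : forall (Z : R -> R) (z : nat -> R -> R),
  (forall s, 0 <= s -> forall j, Rabs (Z s - z j s) <= A s * (/ 2) ^ j) ->
  (forall j s u, Rabs (z j s - z j u) <= B * Rabs (s - u)) ->
  forall s, continuous (fun s => Z (Rmax 0 s)) s).
{ intros Z z HZ Hz s. apply continuous_eps. intros eps He.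
  assert (Hd : 0 < eps / (B + 1)) by (apply Rdiv_lt_0_compat; lra).
  exists (eps / (B + 1)). split; [assumption|]. intros u Hu.
  assert (HZl : Rabs (Z (Rmax 0 u) - Z (Rmax 0 s)) <= B * Rabs (u - s)).
  { apply Rnot_lt_le. intros Hlt.
    set (gap := Rabs (Z (Rmax 0 u) - Z (Rmax 0 s)) - B * Rabs (u - s)) in *.
    destruct (half_pow_small (A (Rmax 0 u) + A (Rmax 0 s)) gap) as [j Hj]; [unfold gap; lra|].
    specialize (Hj j (le_n j)).
    assert (K1 := HZ _ (Hpos u) j). assert (K2 := HZ _ (Hpos s) j).
    assert (K3 := Hz j (Rmax 0 u) (Rmax 0 s)). assert (K4 := Hcl u s).
    assert (K5 : Rabs (Z (Rmax 0 u) - Z (Rmax 0 s)) <= Rabs (Z (Rmax 0 u) - z j (Rmax 0 u))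
      + Rabs (z j (Rmax 0 u) - z j (Rmax 0 s)) + Rabs (Z (Rmax 0 s) - z j (Rmax 0 s))).
    { unfold Rabs; repeat destruct Rcase_abs; lra. }
    unfold gap in Hj. nra. }
  apply Rle_lt_trans with (1 := HZl).
  apply Rle_lt_trans with ((B + 1) * Rabs (u - s)); [generalize (Rabs_pos (u - s)); nra|].
  replace eps with ((B + 1) * (eps / (B + 1))) by (field; lra).
  apply Rmult_lt_compat_l; lra. }
assert (CX : forall s, continuous (fun s => X (Rmax 0 s)) s).
{ apply (Hlip X (fun j => fst (picard j)) HXl). intros; apply picard_lipschitz. }
assert (CY : forall s, continuous (fun s => Y (Rmax 0 s)) s).
{ apply (Hlip Y (fun j => snd (picard j)) HYl). intros; apply picard_lipschitz. }
(* The integral [I] and the limit [Z] are both within a multiple of [(/ 2) ^ j] of the iterate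
   [z (S j)], the first by contraction and the second by construction; hence they coincide. *)
assert (Hfix : forall (F : R -> R -> R) (c : R) (Z : R -> R) (z : nat -> R -> R),
  (forall x1 y1 x2 y2, Rabs (F x1 y1 - F x2 y2) <= L * (Rabs (x1 - x2) + Rabs (y1 - y2))) ->
  (forall s, 0 <= s -> forall j, Rabs (Z s - z j s) <= A s * (/ 2) ^ j) ->
  (forall j, z j 0 = c) ->
  (forall j s, is_derive (z (S j)) s (F (fst (picard j) s) (snd (picard j) s))) ->
  forall s, 0 <= s -> c + RInt (fun u => F (X (Rmax 0 u)) (Y (Rmax 0 u))) 0 s = Z s).
{ intros F c Z z HF HZ Hz0 Hz s Hs.
  set (I := fun s => c + RInt (fun u => F (X (Rmax 0 u)) (Y (Rmax 0 u))) 0 s).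
  change (I s = Z s).
  assert (HI : forall u, is_derive I u (F (X (Rmax 0 u)) (Y (Rmax 0 u)))).
  { apply derive_primitive. intros u.
    apply (lipschitz_comp_continuous F HF (fun s => X (Rmax 0 s)) (fun s => Y (Rmax 0 s))); auto. }
  assert (I0 : I 0 = c).
  { unfold I. rewrite (RInt_point 0 (fun u => F (X (Rmax 0 u)) (Y (Rmax 0 u)))). unfold zero; simpl. ring. }
  assert (Hj : forall j, Rabs (I s - Z s) <= 2 * A s * (/ 2) ^ j).
  { intros j.
    assert (HC : 0 <= 2 * (B / L) * (/ 2) ^ j).
    { apply Rmult_le_pos; [|apply pow_le; lra]. apply Rmult_le_pos; [lra|]. apply Rdiv_le_0_compat; lra. }
    assert (K : Rabs (I s - z (S j) s) <= 2 * (B / L) * (/ 2) ^ j / 2 * exp (4 * L * s)).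
    { apply (weighted_contraction I (z (S j)) (fun u => F (X (Rmax 0 u)) (Y (Rmax 0 u)))
        (fun u => F (fst (picard j) u) (snd (picard j) u))); auto.
      - rewrite I0. symmetry. apply Hz0.
      - intros u Hu. apply Rle_trans with (1 := HF _ _ _ _).
        rewrite Rmax_right by lra.
        assert (K1 := HXl u (proj1 Hu) j). assert (K2 := HYl u (proj1 Hu) j). unfold A in K1, K2.
        replace (2 * L * (2 * (B / L) * (/ 2) ^ j) * exp (4 * L * u)) with
          (L * (2 * (B / L * exp (4 * L * u)) * (/ 2) ^ j + 2 * (B / L * exp (4 * L * u)) * (/ 2) ^ j)) by ring.
        apply Rmult_le_compat_l; lra. }
    assert (K2 := HZ s Hs (S j)).
    assert (K3 : Rabs (I s - Z s) <= Rabs (I s - z (S j) s) + Rabs (Z s - z (S j) s)).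
    { unfold Rabs; repeat destruct Rcase_abs; lra. }
    unfold A in *. simpl pow in K2.
    assert (0 <= B / L * exp (4 * L * s) * (/ 2) ^ j).
    { apply Rmult_le_pos; [|apply pow_le; lra]. apply Rmult_le_pos; [apply Rdiv_le_0_compat; lra|].
      left; apply exp_pos. }
    lra. }
  destruct (Req_dec (I s) (Z s)) as [|Hn]; [assumption|exfalso].
  assert (Hp : 0 < Rabs (I s - Z s)) by (apply Rabs_pos_lt; lra).
  destruct (half_pow_small (2 * A s) _ Hp) as [j Hj']. specialize (Hj' j (le_n j)).
  specialize (Hj j). lra. }
(* The integrals are taken as witnesses rather than the limits [X] and [Y], with which they agree
   for [s >= 0]: they are differentiable everywhere, including from the left at 0. *)
exists (fun s => x0 + RInt (fun u => f (X (Rmax 0 u)) (Y (Rmax 0 u))) 0 s),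
       (fun s => y0 + RInt (fun u => g (X (Rmax 0 u)) (Y (Rmax 0 u))) 0 s).
assert (EX := Hfix f x0 X (fun j => fst (picard j)) f_lipschitz HXl
  (fun j => proj1 (picard_init j)) (fun j s => proj1 (picard_derive j s))).
assert (EY := Hfix g y0 Y (fun j => snd (picard j)) g_lipschitz HYl
  (fun j => proj2 (picard_init j)) (fun j s => proj2 (picard_derive j s))).
assert (E0 : forall F : R -> R, RInt F 0 0 = 0) by (intros F; apply (RInt_point 0 F)).
split; [rewrite E0; ring|]. split; [rewrite E0; ring|]. intros s Hs. split.
- rewrite EX, EY by assumption. replace (f (X s) (Y s)) with (f (X (Rmax 0 s)) (Y (Rmax 0 s)))
    by (now rewrite Rmax_right).
  exact (derive_primitive (fun u => f (X (Rmax 0 u)) (Y (Rmax 0 u))) x0 (fun u =>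
    lipschitz_comp_continuous f f_lipschitz (fun s => X (Rmax 0 s)) (fun s => Y (Rmax 0 s)) u (CX u) (CY u)) s).
- rewrite EX, EY by assumption. replace (g (X s) (Y s)) with (g (X (Rmax 0 s)) (Y (Rmax 0 s)))
    by (now rewrite Rmax_right).
  exact (derive_primitive (fun u => g (X (Rmax 0 u)) (Y (Rmax 0 u))) y0 (fun u =>
    lipschitz_comp_continuous g g_lipschitz (fun s => X (Rmax 0 s)) (fun s => Y (Rmax 0 s)) u (CX u) (CY u)) s).
Qed.

End Picard.

(** * The autonomous system *)

Lemma Derive_eta (f : R -> R) (x l : R) : is_derive f x l -> Derive (fun y : R => f y) x = l.
Proof. apply is_derive_unique. Qed.

(** [E * exp (- K * s)] is nonincreasing and [E * exp (K * s)] nondecreasing; the first propagates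
    the zero to the right of [s0], the second to the left. *)
Lemma gronwall_zero (E dE : R -> R) (K a b s0 : R) :
  a <= s0 <= b -> (forall s, a <= s <= b -> is_derive E s (dE s)) ->
  (forall s, a <= s <= b -> 0 <= E s) ->
  (forall s, a <= s <= b -> Rabs (dE s) <= K * E s) ->
  E s0 = 0 -> forall s, a <= s <= b -> E s = 0.
Proof.
intros Hs0 HD Hpos HK H0 s Hs.
assert (Hexp : forall c u, a <= u <= b ->
  is_derive (fun u => E u * exp (c * u)) u ((dE u + c * E u) * exp (c * u))).
{ intros c u Hu. auto_derive.
  - exact (ex_intro _ _ (HD u Hu)).
  - rewrite (Derive_eta _ u _ (HD u Hu)). ring. }
assert (Hbd : forall u, a <= u <= b -> - (K * E u) <= dE u <= K * E u).
{ intros u Hu. now apply Rabs_le_between, HK. }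
assert (Hp := Hpos s Hs).
destruct (Rle_lt_dec s0 s) as [Hle|Hle].
- assert (Q : - (E s0 * exp (- K * s0)) <= - (E s * exp (- K * s))).
  { apply (derive_nonneg_le (fun u => - (E u * exp (- K * u))) (fun u => - ((dE u + - K * E u) * exp (- K * u)))); [assumption| |].
    - intros u Hu. apply (is_derive_opp (K := R_AbsRing) (fun u => E u * exp (- K * u))). apply Hexp. lra.
    - intros u Hu. assert (0 < exp (- K * u)) by apply exp_pos. specialize (Hbd u). nra. }
  rewrite H0 in Q. assert (0 < exp (- K * s)) by apply exp_pos. nra.
- assert (Q : E s * exp (K * s) <= E s0 * exp (K * s0)).
  { apply (derive_nonneg_le (fun u => E u * exp (K * u)) (fun u => (dE u + K * E u) * exp (K * u))); [lra| |].
    - intros u Hu. apply Hexp. lra.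
    - intros u Hu. assert (0 < exp (K * u)) by apply exp_pos. specialize (Hbd u). nra. }
  rewrite H0 in Q. assert (0 < exp (K * s)) by apply exp_pos. nra.
Qed.

Section Trajectories.

Variable m : nat.
Hypothesis m_12 : m = 1%nat \/ m = 2%nat.
Variables k dk : R -> R.
Hypothesis k_derive : forall J, 0 < J -> is_derive k J (dk J).
Hypothesis dk_pos : forall J, 0 < J -> 0 < dk J.

Let M := INR m.

(** The Jacobian [r' * (r / R)^(n-1) = t * (r / R)^n] of the deformation, with [n = M + 1] and
    [w = ln (r / R)]. *)
Definition vol (t w : R) : R := t * exp ((M + 1) * w).
Definition stress (t w : R) : R := t ^ m + k (vol t w) + M * w.
(** This is [t + ... + t^m], the quotient of [t * (1 - t^m)] by [1 - t]. Splitting off [1 - t] makes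
    it cancel against [w' = t - 1] when the stress is differentiated with respect to [w]. *)
Definition growth (t : R) : R := t * sum_f_R0 (pow t) (m - 1).

Lemma M_12 : M = 1 \/ M = 2.
Proof. unfold M. destruct m_12 as [-> | ->]; simpl; lra. Qed.

Lemma growth_eq (t : R) : (1 - t) * growth t = t * (1 - t ^ m).
Proof. unfold growth. destruct m_12 as [-> | ->]; simpl; ring. Qed.

Lemma growth_bounds (t : R) : 0 < t -> t <= growth t <= t + t ^ 2.
Proof. intros Ht. unfold growth. destruct m_12 as [-> | ->]; simpl; nra. Qed.

Lemma growth_le (x y : R) : 0 < x <= y -> growth x <= growth y.
Proof. intros Ht. unfold growth. destruct m_12 as [-> | ->]; simpl; nra. Qed.

(** [t + t^2 <= 5/16] for [t <= / 4]. A slope below half of [M] is what the comparison of two stress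
    graphs requires. *)
Lemma growth_small (t : R) : 0 < t <= / 4 -> M * growth t < / 2 * M.
Proof. intros Ht. generalize M_12 (growth_bounds t). simpl. nra. Qed.

Lemma pow_incr_strict (x y : R) : 0 < x < y -> x ^ m < y ^ m.
Proof. intros H. destruct m_12 as [-> | ->]; simpl; nra. Qed.

Lemma pow_le_incr (x y : R) : 0 < x <= y -> x ^ m <= y ^ m.
Proof. intros H. destruct m_12 as [-> | ->]; simpl; nra. Qed.

Lemma pow_gap (a x y : R) : 0 < a <= 1 -> a <= x <= y -> a * (y - x) <= y ^ m - x ^ m.
Proof. intros Ha H. destruct m_12 as [-> | ->]; simpl; nra. Qed.

Lemma pow_slope (t : R) : M * t ^ (m - 1) = 1 \/ M * t ^ (m - 1) = 2 * t.
Proof. unfold M. destruct m_12 as [-> | ->]; simpl; lra. Qed.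

Lemma pow_quotient (t : R -> R) (s : R) : 0 < t s -> continuous t s ->
  exists gp : R -> R, (forall u, t u ^ m - t s ^ m = gp u * (t u - t s)) /\ continuous gp s
    /\ gp s = M * t s ^ (m - 1) /\ forall u, 0 < t u -> 0 < gp u.
Proof.
intros Ht Ct. unfold M. destruct m_12 as [-> | ->].
- exists (fun _ => 1). split; [intros; simpl; ring|]. split; [apply continuous_const|].
  split; [simpl; ring|]. intros; lra.
- exists (fun u => t u + t s). split; [intros; simpl; ring|]. split.
  + apply (continuous_plus (V := R_NormedModule) t (fun _ => t s)); [assumption|apply continuous_const].
  + split; [simpl; ring|]. intros; lra.
Qed.

Lemma k_lt (x y : R) : 0 < x < y -> k x < k y.
Proof.
intros H. apply (derive_pos_lt k dk); [lra| |]; intros u Hu.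
- apply k_derive. lra. - apply dk_pos. lra.
Qed.

Lemma k_le (x y : R) : 0 < x <= y -> k x <= k y.
Proof.
intros [Hx [Hlt| ->]]; [|lra]. left. now apply k_lt.
Qed.

Lemma vol_pos (t w : R) : 0 < t -> 0 < vol t w.
Proof. intros Ht. apply Rmult_lt_0_compat; [assumption|apply exp_pos]. Qed.

Lemma exp_le (x y : R) : x <= y -> exp x <= exp y.
Proof. intros [H| ->]; [left; now apply exp_increasing|lra]. Qed.

Lemma vol_le (t1 t2 w1 w2 : R) : 0 < t1 <= t2 -> w1 <= w2 -> vol t1 w1 <= vol t2 w2.
Proof.
intros Ht Hw. unfold vol. generalize (exp_pos ((M + 1) * w1)); intros.
assert (exp ((M + 1) * w1) <= exp ((M + 1) * w2)).
{ apply exp_le. generalize M_12. nra. }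
apply Rmult_le_compat; lra.
Qed.

Lemma stress_gap_t (t1 t2 w : R) : 0 < t1 <= t2 -> t2 ^ m - t1 ^ m <= stress t2 w - stress t1 w.
Proof.
intros Ht. unfold stress.
assert (k (vol t1 w) <= k (vol t2 w)); [|lra].
apply k_le. split; [apply vol_pos; tauto|]. apply vol_le; lra.
Qed.

Lemma stress_lt_t (t1 t2 w : R) : 0 < t1 < t2 -> stress t1 w < stress t2 w.
Proof.
intros Ht. assert (t1 ^ m < t2 ^ m) by (apply pow_incr_strict; lra).
assert (t2 ^ m - t1 ^ m <= stress t2 w - stress t1 w) by (apply stress_gap_t; lra). lra.
Qed.

(** All three terms of [stress] are nondecreasing in both variables, and the linear term alone
    supplies the gap. *)
Lemma stress_gap_w (t1 t2 w1 w2 : R) :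
  0 < t1 <= t2 -> w1 <= w2 -> M * (w2 - w1) <= stress t2 w2 - stress t1 w1.
Proof.
intros Ht Hw. unfold stress.
assert (t1 ^ m <= t2 ^ m) by (apply pow_le_incr; lra).
assert (k (vol t1 w1) <= k (vol t2 w2)); [|lra].
apply k_le. split; [apply vol_pos; tauto|]. now apply vol_le.
Qed.

Lemma stress_inj_t (t1 t2 w : R) : 0 < t1 -> 0 < t2 -> stress t1 w = stress t2 w -> t1 = t2.
Proof.
intros H1 H2 E. destruct (Rtotal_order t1 t2) as [H|[H|H]]; [|assumption|].
- generalize (stress_lt_t t1 t2 w). lra.
- generalize (stress_lt_t t2 t1 w). lra.
Qed.

Lemma exp_M_derive (w : R -> R) (s dw : R) :
  is_derive w s dw ->
  is_derive (fun s => exp ((M + 1) * w s)) s ((M + 1) * dw * exp ((M + 1) * w s)).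
Proof.
intros Hw. auto_derive.
- now exists dw.
- rewrite (Derive_eta _ s _ Hw). ring.
Qed.

Lemma stress_derive (t w : R -> R) (s dt dw : R) :
  0 < t s -> is_derive t s dt -> is_derive w s dw ->
  is_derive (fun s => stress (t s) (w s)) s
    (M * t s ^ (m - 1) * dt
     + dk (vol (t s) (w s)) * (dt + (M + 1) * t s * dw) * exp ((M + 1) * w s) + M * dw).
Proof.
intros Ht Dt Dw. unfold stress, vol.
assert (HJ := vol_pos (t s) (w s) Ht).
assert (Dk := k_derive _ HJ). unfold vol in HJ, Dk.
auto_derive.
- repeat match goal with |- _ /\ _ => split end; trivial; eexists; eassumption.
- rewrite (Derive_eta _ s _ Dt), (Derive_eta _ s _ Dw).
  rewrite (Derive_eta _ _ _ Dk).
  replace (Init.Nat.pred m) with (m - 1)%nat by lia. unfold M. ring.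
Qed.

(** The root [t] of [stress t w = T], projected to [[a, 1]]: inside the interval the two
    disjunctions give equality, at an end only one inequality survives. The projection gives a value
    for every [(w, T)], which makes the field global, bounded and Lipschitz, as Picard iteration
    demands. *)
Definition clamped (a w T t : R) : Prop :=
  a <= t <= 1 /\ (t = a \/ stress t w <= T) /\ (t = 1 \/ T <= stress t w).

Lemma stress_continuous_t (t w : R) : 0 < t -> continuous (fun t => stress t w) t.
Proof.
intros Ht. eapply is_derive_continuous.
apply (stress_derive (fun t => t) (fun _ => w) t 1 0 Ht).
- exact (is_derive_id t).
- exact (is_derive_const w t).
Qed.

Lemma stress_continuous_w (t w : R) : 0 < t -> continuous (stress t) w.
Proof.
intros Ht. eapply is_derive_continuous.
apply (stress_derive (fun _ => t) (fun w => w) w 0 1 Ht).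
- exact (is_derive_const t w).
- exact (is_derive_id w).
Qed.

Lemma clamped_exists (a w T : R) : 0 < a <= 1 -> exists t, clamped a w T t.
Proof.
intros Ha. destruct (Rle_lt_dec T (stress a w)) as [H1|H1].
- exists a. repeat split; try lra; auto.
- destruct (Rle_lt_dec (stress 1 w) T) as [H2|H2].
  + exists 1. repeat split; try lra; auto.
  + destruct (IVT_interval (fun t => stress t w) a 1 T) as [t [Ht E]].
    * lra.
    * intros x Hx. apply stress_continuous_t. lra.
    * rewrite Rmin_left, Rmax_right; lra.
    * exists t. repeat split; try lra; right; lra.
Qed.

(** Let [t2 < t1]. If the volumes are ordered the same way, the [k] terms have a favourable sign and
    the slope of the power [t^m], at least [a], bounds [t1 - t2]. Otherwise
    [t1 * exp (- (M + 1) * (w2 - w1)) < t2], and [w2 - w1] alone bounds it. No bound on [dk]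
    enters. *)
Lemma clamped_lipschitz (a w1 T1 t1 w2 T2 t2 : R) :
  0 < a <= 1 -> clamped a w1 T1 t1 -> clamped a w2 T2 t2 ->
  Rabs (t1 - t2) <= (M + 1) / a * (Rabs (w1 - w2) + Rabs (T1 - T2)).
Proof.
intros Ha.
assert (Hmain : forall w1 T1 t1 w2 T2 t2, clamped a w1 T1 t1 -> clamped a w2 T2 t2 -> t2 < t1 ->
  a * (t1 - t2) <= (M + 1) * (Rabs (w1 - w2) + Rabs (T1 - T2))).
{ clear w1 T1 t1 w2 T2 t2. intros w1 T1 t1 w2 T2 t2 (B1 & L1 & U1) (B2 & L2 & U2) Hlt.
  (* Since [a <= t2 < t1 <= 1], [t1] is not at the lower end and [t2] not at the upper one, which
     selects the useful inequalities. *)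
  assert (E1 : stress t1 w1 <= T1) by (destruct L1; lra).
  assert (E2 : T2 <= stress t2 w2) by (destruct U2; lra).
  assert (HM := M_12). unfold stress in E1, E2.
  generalize (Rabs_pos (w1 - w2)) (Rabs_pos (T1 - T2)) (Rle_abs (T1 - T2)); intros P1 P2 P3.
  assert (P4 := Rle_abs (w2 - w1)). rewrite Rabs_minus_sym in P4.
  assert (HM1 : 0 < M) by lra.
  assert (Q1 : M * (w2 - w1) <= M * Rabs (w1 - w2)) by (apply Rmult_le_compat_l; lra).
  assert (Q2 : 0 <= M * Rabs (T1 - T2)) by (apply Rmult_le_pos; lra).
  assert (Q3 : 0 <= M * Rabs (w1 - w2)) by (apply Rmult_le_pos; lra).
  destruct (Rle_lt_dec (vol t2 w2) (vol t1 w1)) as [HJ|HJ].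
  - assert (k (vol t2 w2) <= k (vol t1 w1)).
    { apply k_le. split; [apply vol_pos; lra|assumption]. }
    assert (a * (t1 - t2) <= t1 ^ m - t2 ^ m) by (apply pow_gap; lra).
    lra.
  - assert (Hexp : 1 - (M + 1) * (w2 - w1) <= exp (- ((M + 1) * (w2 - w1)))).
    { generalize (exp_ineq1_le (- ((M + 1) * (w2 - w1)))). lra. }
    assert (HJ' : t1 * exp (- ((M + 1) * (w2 - w1))) < t2).
    { unfold vol in HJ. apply Rmult_lt_reg_r with (exp ((M + 1) * w2)); [apply exp_pos|].
      rewrite Rmult_assoc, <- exp_plus.
      replace (- ((M + 1) * (w2 - w1)) + (M + 1) * w2) with ((M + 1) * w1) by ring. assumption. }
    assert (t1 * (1 - (M + 1) * (w2 - w1)) <= t1 * exp (- ((M + 1) * (w2 - w1)))).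
    { apply Rmult_le_compat_l; lra. }
    assert (t1 * ((M + 1) * (w2 - w1)) <= t1 * ((M + 1) * Rabs (w1 - w2))).
    { apply Rmult_le_compat_l; [lra|]. apply Rmult_le_compat_l; lra. }
    assert (t1 * ((M + 1) * Rabs (w1 - w2)) <= 1 * ((M + 1) * Rabs (w1 - w2))).
    { apply Rmult_le_compat_r; lra. }
    assert (a * (t1 - t2) <= 1 * (t1 - t2)) by (apply Rmult_le_compat_r; lra).
    lra. }
intros C1 C2.
assert (HM := M_12).
apply Rmult_le_reg_l with a; [lra|].
replace (a * ((M + 1) / a * (Rabs (w1 - w2) + Rabs (T1 - T2))))
  with ((M + 1) * (Rabs (w1 - w2) + Rabs (T1 - T2))) by (field; lra).
destruct (Rtotal_order t1 t2) as [H|[H|H]].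
- rewrite (Rabs_minus_sym t1), (Rabs_minus_sym w1), (Rabs_minus_sym T1), (Rabs_pos_eq (t2 - t1)) by lra. now apply Hmain.
- rewrite H, Rminus_diag, Rabs_R0.
  generalize (Rabs_pos (w1 - w2)) (Rabs_pos (T1 - T2)). nra.
- rewrite (Rabs_pos_eq (t1 - t2)) by lra. now apply Hmain.
Qed.

Definition clamped_solution (a s1 s2 : R) (w T t : R -> R) : Prop :=
  forall s, s1 <= s <= s2 -> clamped a (w s) (T s) (t s) /\
    is_derive w s (t s - 1) /\ is_derive T s (M * ((1 - t s) * growth (t s))).

(** The field is [M * (t - t^(m+1))]; on [(0, 1]] the divided difference of [t - t^(m+1)] is bounded
    by 4, and [M <= 2]. *)
Lemma field_lipschitz (x y : R) : 0 < x <= 1 -> 0 < y <= 1 ->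
  Rabs (M * ((1 - x) * growth x) - M * ((1 - y) * growth y)) <= 8 * Rabs (x - y).
Proof.
intros Hx Hy. rewrite <- Rmult_minus_distr_l, Rabs_mult, (Rabs_pos_eq M) by (generalize M_12; lra).
assert (Rabs ((1 - x) * growth x - (1 - y) * growth y) <= 4 * Rabs (x - y)).
{ assert (exists q, (1 - x) * growth x - (1 - y) * growth y = q * (x - y) /\ Rabs q <= 4) as [q [-> Hq]].
  - rewrite !growth_eq. destruct m_12 as [-> | ->].
    + exists (1 - (x + y)). split; [simpl; ring|]. apply Rabs_le. lra.
    + exists (1 - (x * x + x * y + y * y)). split; [simpl; ring|]. apply Rabs_le. nra.
  - rewrite Rabs_mult. apply Rmult_le_compat_r; [apply Rabs_pos|assumption]. }
generalize (Rabs_pos ((1 - x) * growth x - (1 - y) * growth y)) M_12. nra.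
Qed.

Lemma clamped_unique (a s1 s2 s0 : R) (w T t w' T' t' : R -> R) :
  0 < a <= 1 -> s1 <= s0 <= s2 ->
  clamped_solution a s1 s2 w T t -> clamped_solution a s1 s2 w' T' t' ->
  w s0 = w' s0 -> T s0 = T' s0 -> forall s, s1 <= s <= s2 -> w s = w' s /\ T s = T' s.
Proof.
intros Ha Hs0 H H' Ew ET s Hs.
set (E := fun s => (w s - w' s) ^ 2 + (T s - T' s) ^ 2).
set (q := fun t => M * ((1 - t) * growth t)).
set (dE := fun s => 2 * (w s - w' s) * (t s - t' s) + 2 * (T s - T' s) * (q (t s) - q (t' s))).
set (lam := (M + 1) / a).
assert (Hlam : 0 < lam) by (apply Rdiv_lt_0_compat; generalize M_12; lra).
assert (E s = 0).
(* With [X] and [Y] the absolute differences in [w] and [T], the derivative of [E] is at most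
   [lam * (2 X^2 + 18 X Y + 16 Y^2)], where 8 is the Lipschitz constant of the field in [t]; the
   factor 36 is a generous bound for this form. *)
{ apply (gronwall_zero E dE (36 * lam) s1 s2 s0); auto.
  - intros u Hu. destruct (H u Hu) as (_ & Dw & DT). destruct (H' u Hu) as (_ & Dw' & DT').
    unfold E, dE. auto_derive.
    + repeat match goal with |- _ /\ _ => split end; trivial; eexists; eassumption.
    + rewrite (Derive_eta _ u _ Dw), (Derive_eta _ u _ Dw'),
        (Derive_eta _ u _ DT), (Derive_eta _ u _ DT').
      unfold q. ring.
  - intros u _. unfold E. generalize (pow2_ge_0 (w u - w' u)) (pow2_ge_0 (T u - T' u)). lra.
  - intros u Hu. destruct (H u Hu) as (C & _). destruct (H' u Hu) as (C' & _).
    assert (Ht := clamped_lipschitz _ _ _ _ _ _ _ Ha C C'). fold lam in Ht.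
    assert (Hq : Rabs (q (t u) - q (t' u)) <= 8 * Rabs (t u - t' u)).
    { apply field_lipschitz; [destruct C|destruct C']; lra. }
    unfold dE, E. set (x := w u - w' u) in *. set (y := T u - T' u) in *.
    apply Rle_trans with (1 := Rabs_triang _ _). rewrite !Rabs_mult, (Rabs_pos_eq 2) by lra.
    rewrite <- (pow2_abs x), <- (pow2_abs y).
    set (d := Rabs (t u - t' u)) in *. set (e := Rabs (q (t u) - q (t' u))) in *.
    assert (0 <= Rabs x) by apply Rabs_pos. assert (0 <= Rabs y) by apply Rabs_pos.
    set (X := Rabs x) in *. set (Y := Rabs y) in *.
    assert (A1 : 2 * X * d <= 2 * X * (lam * (X + Y))) by (apply Rmult_le_compat_l; lra).
    assert (A2 : 2 * Y * e <= 2 * Y * (8 * (lam * (X + Y)))) by (apply Rmult_le_compat_l; lra).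
    assert (A3 : 2 * X * (lam * (X + Y)) + 2 * Y * (8 * (lam * (X + Y))) = lam * (2 * X * X + 18 * X * Y + 16 * Y * Y)) by ring.
    assert (A4 : lam * (2 * X * X + 18 * X * Y + 16 * Y * Y) <= lam * (36 * (X ^ 2 + Y ^ 2))).
    { apply Rmult_le_compat_l; [lra|]. assert (0 <= (X - Y) ^ 2) by apply pow2_ge_0. nra. }
    lra.
  - unfold E. rewrite Ew, ET. ring. }
unfold E in H0. generalize (pow2_ge_0 (w s - w' s)) (pow2_ge_0 (T s - T' s)); intros P1 P2.
split; apply Rminus_diag_uniq; apply Rsqr_0_uniq; unfold Rsqr; nra.
Qed.

Lemma clamped_solution_exists (a w0 T0 s0 : R) :
  0 < a <= 1 -> exists w T t : R -> R, w s0 = w0 /\ T s0 = T0 /\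
    forall s2, clamped_solution a s0 s2 w T t.
Proof.
intros Ha.
destruct (choice (fun p t => clamped a (fst p) (snd p) t)) as [tau Htau].
{ intros p. now apply clamped_exists. }
set (q := fun t => M * ((1 - t) * growth t)).
set (f := fun w T => tau (w, T) - 1).
set (g := fun w T => q (tau (w, T))).
set (lam := (M + 1) / a).
assert (Hlam : 0 < lam) by (apply Rdiv_lt_0_compat; generalize M_12; lra).
assert (Htl : forall x1 y1 x2 y2, Rabs (tau (x1, y1) - tau (x2, y2)) <= lam * (Rabs (x1 - x2) + Rabs (y1 - y2))).
{ intros. exact (clamped_lipschitz _ _ _ _ _ _ _ Ha (Htau (x1, y1)) (Htau (x2, y2))). }
assert (Hr : forall p, 0 < tau p <= 1) by (intros p; destruct (Htau p); lra).
(* The field vanishes at [t = 1], so its Lipschitz estimate against that point also bounds it. *)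
assert (HB : forall p, Rabs (q (tau p)) <= 8).
{ intros p. assert (K := field_lipschitz (tau p) 1 (Hr p)). fold (q (tau p)) in K.
  replace (M * ((1 - 1) * growth 1)) with 0 in K by ring. rewrite Rminus_0_r in K.
  apply Rle_trans with (1 := K ltac:(lra)).
  assert (Rabs (tau p - 1) <= 1); [|lra]. specialize (Hr p). apply Rabs_le. lra. }
destruct (planar_ode_exists f g (8 * lam) 8) with (x0 := w0) (y0 := T0) as (x & y & Hx0 & Hy0 & Hxy).
- lra.
- intros. unfold f. replace (tau (x1, y1) - 1 - (tau (x2, y2) - 1)) with (tau (x1, y1) - tau (x2, y2)) by ring.
  apply Rle_trans with (1 := Htl _ _ _ _).
  apply Rmult_le_compat_r; [|lra]. apply Rplus_le_le_0_compat; apply Rabs_pos.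
- intros. apply Rle_trans with (1 := field_lipschitz _ _ (Hr (x1, y1)) (Hr (x2, y2))).
  rewrite Rmult_assoc. apply Rmult_le_compat_l; [lra|]. apply Htl.
- intros p1 p2. unfold f. specialize (Hr (p1, p2)). apply Rabs_le. lra.
- intros p1 p2. apply HB.
- exists (fun s => x (s - s0)), (fun s => y (s - s0)), (fun s => tau (x (s - s0), y (s - s0))).
  rewrite Rminus_diag. split; [assumption|]. split; [assumption|].
  intros s2 s Hs. destruct (Hxy (s - s0)) as [Dx Dy]; [lra|].
  assert (Dshift : forall (z : R -> R) dz, is_derive z (s - s0) dz -> is_derive (fun s => z (s - s0)) s dz).
  { intros z dz Dz. replace dz with (scal 1 dz) by (unfold scal; simpl; unfold mult; simpl; ring).
    apply (is_derive_comp z (fun s => s - s0)); [assumption|]. auto_derive; [trivial|ring]. }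
  split; [exact (Htau (_, _))|]. split; apply Dshift; assumption.
Qed.


(** Differentiability is asked of the stress and not of [t], because this is what the equilibrium
    equation provides; the derivative of [t] is recovered later. The domain reaches back to [-oo],
    the logarithmic image of the centre of the ball. *)
Definition traj (b : R) (w t : R -> R) : Prop :=
  forall s, s < b -> 0 < t s /\ is_derive w s (t s - 1) /\
    is_derive (fun s => stress (t s) (w s)) s (M * ((1 - t s) * growth (t s))).

Lemma locally_lt (s b : R) : s < b -> locally s (fun u => u < b).
Proof.
intros H. assert (Hd : 0 < b - s) by lra. exists (mkposreal _ Hd). intros u Hu.
apply Rabs_def2 in Hu. simpl in Hu. unfold minus, plus, opp in Hu; simpl in Hu. lra.
Qed.

Lemma locally_gt (s b : R) : b < s -> locally s (fun u => b < u).
Proof.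
intros H. assert (Hd : 0 < s - b) by lra. exists (mkposreal _ Hd). intros u Hu.
apply Rabs_def2 in Hu. simpl in Hu. unfold minus, plus, opp in Hu; simpl in Hu. lra.
Qed.

Lemma locally_pos (f : R -> R) (s : R) : continuous f s -> 0 < f s -> locally s (fun u => 0 < f u).
Proof. intros Hc Hp. apply Hc. now apply locally_gt. Qed.

(** By strict monotonicity in [t], the continuous functions [stress (t s - e) (w u)] and
    [stress (t s + e) (w u)] of [u] lie on either side of the continuous function
    [stress (t u) (w u)] near [s], which traps [t u]. *)
Lemma traj_t_continuous (b : R) (w t : R -> R) (s : R) : traj b w t -> s < b -> continuous t s.
Proof.
intros Htr Hs. destruct (Htr s Hs) as (Ht & Dw & DT).
apply continuous_eps. intros eps He.
set (e := Rmin (eps / 2) (t s / 2)).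
assert (He1 : e <= eps / 2) by apply Rmin_l. assert (He2 : e <= t s / 2) by apply Rmin_r.
assert (He0 : 0 < e) by (apply Rmin_glb_lt; lra).
assert (Cw := is_derive_continuous _ _ _ Dw). assert (CT := is_derive_continuous _ _ _ DT).
assert (Hc : forall c, 0 < c -> continuous (fun u => stress c (w u)) s).
{ intros c Hc. apply (continuous_comp w (stress c)); [assumption|]. now apply stress_continuous_w. }
assert (L1 : locally s (fun u => 0 < stress (t u) (w u) - stress (t s - e) (w u))).
{ apply locally_pos.
  - apply (continuous_minus (V := R_NormedModule)); [exact CT|]. apply Hc. lra.
  - assert (stress (t s - e) (w s) < stress (t s) (w s)) by (apply stress_lt_t; lra). lra. }
assert (L2 : locally s (fun u => 0 < stress (t s + e) (w u) - stress (t u) (w u))).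
{ apply locally_pos.
  - apply (continuous_minus (V := R_NormedModule)); [|exact CT]. apply Hc. lra.
  - assert (stress (t s) (w s) < stress (t s + e) (w s)) by (apply stress_lt_t; lra). lra. }
destruct (filter_and _ _ (locally_lt s b Hs) (filter_and _ _ L1 L2)) as [d Hd].
exists d. split; [apply cond_pos|]. intros u Hu. destruct (Hd u Hu) as (Hub & K1 & K2).
destruct (Htr u Hub) as (Htu & _).
assert (t s - e < t u).
{ apply Rnot_le_lt. intros Hle. generalize (stress_gap_w (t u) (t s - e) (w u) (w u)). nra. }
assert (t u < t s + e).
{ apply Rnot_le_lt. intros Hle. generalize (stress_gap_w (t s + e) (t u) (w u) (w u)). nra. }
apply Rabs_def1; lra.
Qed.

(* [t' = rate t w * (1 - t)]: implicit differentiation of [stress t w = T]. *)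
Definition rate (t w : R) : R :=
  (M * (growth t + 1) + (M + 1) * (dk (vol t w) * vol t w))
  / (M * t ^ (m - 1) + dk (vol t w) * exp ((M + 1) * w)).

Lemma rate_den_pos (t w : R) : 0 < t -> 0 < M * t ^ (m - 1) + dk (vol t w) * exp ((M + 1) * w).
Proof.
intros Ht. apply Rplus_lt_0_compat.
- apply Rmult_lt_0_compat; [generalize M_12; lra|]. now apply pow_lt.
- apply Rmult_lt_0_compat; [|apply exp_pos]. now apply dk_pos, vol_pos.
Qed.

Lemma rate_pos (t w : R) : 0 < t -> 0 < rate t w.
Proof.
intros Ht. apply Rdiv_lt_0_compat; [|now apply rate_den_pos].
assert (0 < dk (vol t w) * vol t w) by (apply Rmult_lt_0_compat; [apply dk_pos|]; now apply vol_pos).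
generalize M_12 (growth_bounds t Ht). intros [-> | ->] [G _]; lra.
Qed.

(** [dk] may be unbounded, but it occurs in the numerator and in the denominator of [rate], with
    ratio [(M + 1) * t]. The remaining terms are controlled by the lower bound [beta] of
    [M * t ^ (m - 1)], which is 1 or [2 * t]. *)
Lemma rate_bounded (a c : R) : 0 < a ->
  exists K, 0 < K /\ forall t w, a <= t <= c -> rate t w <= K.
Proof.
intros Ha. set (beta := Rmin 1 (2 * a)).
assert (Hb : 0 < beta) by (apply Rmin_glb_lt; lra).
assert (Hb1 : beta <= 1) by apply Rmin_l. assert (Hb2 : beta <= 2 * a) by apply Rmin_r.
set (A := 2 * (c + c ^ 2 + 1)).
exists (Rabs A / beta + 3 * Rabs c + 1). split.
- assert (0 <= Rabs A / beta) by (apply Rdiv_le_0_compat; [apply Rabs_pos|assumption]).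
  generalize (Rabs_pos c). lra.
- intros t w Ht.
  assert (Hc : Rabs c = c) by (apply Rabs_pos_eq; lra).
  assert (HA : Rabs A = A) by (apply Rabs_pos_eq; unfold A; nra). rewrite Hc, HA.
  assert (Hden := rate_den_pos t w ltac:(lra)).
  apply Rmult_le_reg_r with (1 := Hden). unfold rate.
  rewrite Rdiv_def, Rmult_assoc, Rinv_l, Rmult_1_r by lra.
  set (q := dk (vol t w) * exp ((M + 1) * w)) in *.
  assert (Hq : 0 < q) by (apply Rmult_lt_0_compat; [apply dk_pos, vol_pos; lra|apply exp_pos]).
  replace (dk (vol t w) * vol t w) with (q * t) by (unfold q, vol; ring).
  assert (Hpow : beta <= M * t ^ (m - 1)).
  { destruct (pow_slope t) as [-> | ->]; lra. }
  assert (HG := growth_bounds t ltac:(lra)).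
  assert (Hnum : M * (growth t + 1) <= A).
  { unfold A. assert (growth t <= c + c ^ 2) by nra. generalize M_12. intros [-> | ->]; nra. }
  assert (HAb : A <= A / beta * (M * t ^ (m - 1))).
  { replace A with (A / beta * beta) at 1 by (field; lra). apply Rmult_le_compat_l; [|assumption].
    apply Rdiv_le_0_compat; [unfold A; nra|assumption]. }
  assert (0 <= A / beta * q).
  { apply Rmult_le_pos; [|lra]. apply Rdiv_le_0_compat; [unfold A; nra|assumption]. }
  assert ((M + 1) * (q * t) <= 3 * c * q).
  { apply Rle_trans with (3 * (q * t)); [|nra]. apply Rmult_le_compat_r; [nra|]. generalize M_12; lra. }
  assert (0 <= (3 * c + 1) * (M * t ^ (m - 1))) by (apply Rmult_le_pos; lra).
  lra.
Qed.

(** Writing each increment in the stress relation with its Caratheodory quotient gives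
    [den u * (t u - t s) = num u * (u - s)], with [num] and [den] continuous at [s]. This implicit
    differentiation only uses the derivative of [k] at one point. *)
Lemma traj_t_derive (b : R) (w t : R -> R) (s : R) :
  traj b w t -> s < b -> is_derive t s (rate (t s) (w s) * (1 - t s)).
Proof.
intros Htr Hs. destruct (Htr s Hs) as (Ht & Dw & DT).
assert (Ct := traj_t_continuous _ _ _ _ Htr Hs).
assert (HJ := vol_pos (t s) (w s) Ht).
assert (Cw := is_derive_continuous _ _ _ Dw).
assert (De := exp_M_derive w s _ Dw).
assert (Ce := is_derive_continuous _ _ _ De).
destruct (caratheodory _ _ _ Dw) as [fw [Ew [Cfw Vw]]].
destruct (caratheodory _ _ _ DT) as [fT [ET [CfT VT]]].
destruct (caratheodory _ _ _ De) as [fe [Ee [Cfe Ve]]].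
destruct (caratheodory _ _ _ (k_derive _ HJ)) as [fk [Ek [Cfk Vk]]].
destruct (pow_quotient t s Ht Ct) as (gp & Egp & Cgp & Vgp & Pgp).
set (e := fun s => exp ((M + 1) * w s)) in *.
set (J := fun u => vol (t u) (w u)).
assert (CJ : continuous J s).
{ apply (continuous_mult (K := R_AbsRing) t e); assumption. }
assert (CfkJ : continuous (fun u => fk (J u)) s) by (apply (continuous_comp J fk); assumption).
set (num := fun u => fT u - fk (J u) * (t s * fe u) - M * fw u).
set (den := fun u => gp u + fk (J u) * e u).
(* Away from the base point the quotient of [k] is positive because [k] is strictly increasing; at
   the base point it equals [dk]. Hence [den] can be divided by. *)
assert (Pk : forall u, 0 < t u -> 0 < fk (J u)).
{ intros u Hu. assert (HJu := vol_pos (t u) (w u) Hu). specialize (Ek (J u)).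
  destruct (Rtotal_order (J u) (vol (t s) (w s))) as [H|[H|H]].
  - assert (k (J u) < k (vol (t s) (w s))) by (now apply k_lt). nra.
  - rewrite H, Vk. now apply dk_pos.
  - assert (k (vol (t s) (w s)) < k (J u)) by (now apply k_lt). nra. }
assert (Pden : forall u, 0 < t u -> 0 < den u).
{ intros u Hu. unfold den. assert (0 < fk (J u) * e u).
  { apply Rmult_lt_0_compat; [now apply Pk|apply exp_pos]. }
  specialize (Pgp u Hu). lra. }
assert (Cpsi : continuous (fun u => num u / den u) s).
{ apply (continuous_mult (K := R_AbsRing) num (fun u => / den u)).
  - unfold num. apply (continuous_minus (V := R_NormedModule) (fun u => fT u - fk (J u) * (t s * fe u)) (fun u => M * fw u)).
    + apply (continuous_minus (V := R_NormedModule) fT (fun u => fk (J u) * (t s * fe u))); [assumption|].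
      apply (continuous_mult (K := R_AbsRing) (fun u => fk (J u)) (fun u => t s * fe u)); [assumption|].
      apply (continuous_mult (K := R_AbsRing) (fun u => t s) fe); [apply continuous_const|assumption].
    + apply (continuous_mult (K := R_AbsRing) (fun u => M) fw); [apply continuous_const|assumption].
  - apply continuous_comp with (g := Rinv).
    + unfold den. apply (continuous_plus (V := R_NormedModule) gp (fun u => fk (J u) * e u)); [assumption|].
      apply (continuous_mult (K := R_AbsRing) (fun u => fk (J u)) e); assumption.
    + apply continuous_Rinv. generalize (Pden s Ht). lra. }
assert (Hval : num s / den s = rate (t s) (w s) * (1 - t s)).
{ unfold num, den, rate, J. rewrite VT, Vk, Ve, Vw, Vgp. unfold e.
  assert (Hd := rate_den_pos (t s) (w s) Ht). revert Hd.
  set (D := dk (vol (t s) (w s))). unfold vol. generalize (t s ^ (m - 1)). intros p Hd. field. lra. }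
rewrite <- Hval. apply (caratheodory_derive t (fun u => num u / den u)); [|assumption].
generalize (locally_lt s b Hs). apply filter_imp. intros u Hu.
destruct (Htr u Hu) as (Htu & _).
assert (HE : den u * (t u - t s) = num u * (u - s)).
{ unfold num, den. specialize (Ew u). specialize (ET u). specialize (Ee u). specialize (Ek (J u)).
  specialize (Egp u). unfold stress in ET.
  assert (EJ : J u - vol (t s) (w s) = (t u - t s) * e u + t s * (e u - e s)) by (unfold J, vol, e; ring).
  assert (Ee' : e u - e s = fe u * (u - s)) by exact Ee. rewrite Ee' in EJ. rewrite EJ in Ek. fold (J u) in ET.
  assert (X1 : fT u * (u - s) = (t u ^ m - t s ^ m) + (k (J u) - k (vol (t s) (w s))) + M * (w u - w s)) by (rewrite <- ET; ring).
  rewrite Egp, Ek, Ew in X1.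
  replace ((fT u - fk (J u) * (t s * fe u) - M * fw u) * (u - s)) with
    (fT u * (u - s) - fk (J u) * (t s * fe u) * (u - s) - M * fw u * (u - s)) by ring.
  rewrite X1. ring. }
specialize (Pden u Htu). apply Rmult_eq_reg_l with (den u); [|lra]. rewrite HE. field. lra.
Qed.

Lemma traj_t_bounds (b : R) (w t : R -> R) (s1 s2 : R) :
  traj b w t -> s1 <= s2 < b -> exists a c, 0 < a /\ forall s, s1 <= s <= s2 -> a <= t s <= c.
Proof.
intros Htr Hs.
assert (Hc : forall s, s1 <= s <= s2 -> continuity_pt t s).
{ intros s Hs'. apply continuity_pt_filterlim. apply (traj_t_continuous b w t); [assumption|lra]. }
destruct (continuity_ab_min t s1 s2 (proj1 Hs) Hc) as [x [Hx Hx']].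
destruct (continuity_ab_maj t s1 s2 (proj1 Hs) Hc) as [y [Hy Hy']].
exists (t x), (t y). split.
- apply (Htr x). lra.
- intros s Hs'. split; [now apply Hx|now apply Hy].
Qed.

(** Gronwall for [(1 - t)^2]: the equation for [1 - t] is linear with coefficient [- rate], and
    [rate] is bounded because [t] stays in a compact subset of the positive axis between [s0] and
    [s]. *)
Lemma traj_t_eq_1 (b : R) (w t : R -> R) (s0 s : R) :
  traj b w t -> s0 < b -> s < b -> t s0 = 1 -> t s = 1.
Proof.
intros Htr Hs0 Hs E.
assert (Hmin : Rmin s0 s <= Rmax s0 s) by (apply Rle_trans with s0; [apply Rmin_l|apply Rmax_l]).
assert (Hmax : Rmax s0 s < b) by (now apply Rmax_lub_lt).
destruct (traj_t_bounds b w t (Rmin s0 s) (Rmax s0 s) Htr (conj Hmin Hmax)) as (a & c & Ha & Hac).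
destruct (rate_bounded a c Ha) as (K & HK & HKb).
assert (Z : (1 - t s) ^ 2 = 0).
{ apply (gronwall_zero (fun u => (1 - t u) ^ 2) (fun u => - (2 * rate (t u) (w u) * (1 - t u) ^ 2)) (2 * K) (Rmin s0 s) (Rmax s0 s) s0).
  - split; [apply Rmin_l|apply Rmax_l].
  - intros u Hu. assert (Dt := traj_t_derive b w t u Htr ltac:(lra)).
    auto_derive; [now exists (rate (t u) (w u) * (1 - t u))|].
    rewrite (Derive_eta _ _ _ Dt). ring.
  - intros u _. apply pow2_ge_0.
  - intros u Hu. specialize (Hac u Hu). specialize (HKb (t u) (w u) Hac).
    assert (Hr := rate_pos (t u) (w u) ltac:(lra)). assert (Hsq := pow2_ge_0 (1 - t u)).
    rewrite Rabs_Ropp, Rabs_pos_eq by nra. nra.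
  - rewrite E. ring.
  - split; [apply Rmin_r|apply Rmax_r]. }
assert (1 - t s = 0); [|lra]. apply Rsqr_0_uniq. unfold Rsqr. simpl in Z. lra.
Qed.

Lemma traj_t_side (b : R) (w t : R -> R) (s0 s : R) :
  traj b w t -> s0 < b -> s < b -> (t s0 < 1 -> t s < 1) /\ (1 < t s0 -> 1 < t s).
Proof.
intros Htr Hs0 Hs.
assert (Hmin : Rmin s0 s <= Rmax s0 s) by (apply Rle_trans with s0; [apply Rmin_l|apply Rmax_l]).
assert (Hmax : Rmax s0 s < b) by (now apply Rmax_lub_lt).
assert (Hno : t s0 <> 1 -> ~ (Rmin (t s0) (t s) <= 1 <= Rmax (t s0) (t s))).
{ intros Hn Hb.
  destruct (IVT_interval t (Rmin s0 s) (Rmax s0 s) 1) as (c & Hc & Ec); [assumption| | |].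
  - intros x Hx. apply (traj_t_continuous b w t); [assumption|lra].
  - destruct (Rle_lt_dec s0 s).
    + rewrite (Rmin_left s0 s), (Rmax_right s0 s) by lra. assumption.
    + rewrite (Rmin_right s0 s), (Rmax_left s0 s) by lra. now rewrite Rmin_comm, Rmax_comm.
  - apply Hn. apply (traj_t_eq_1 b w t c s0); try assumption. lra. }
split; intros H.
- apply Rnot_le_lt. intros Hge. apply Hno; [lra|]. rewrite Rmin_left, Rmax_right; lra.
- apply Rnot_le_lt. intros Hge. apply Hno; [lra|]. rewrite Rmin_right, Rmax_left; lra.
Qed.

(** * Trajectories with [t < 1], that is [r' < r / R]: monotonicity and forward uniqueness *)

Definition tangential (b : R) (w t : R -> R) : Prop := traj b w t /\ forall s, s < b -> t s < 1.

Lemma tangential_t_le (b : R) (w t : R -> R) (s u : R) : tangential b w t -> s <= u < b -> t s <= t u.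
Proof.
intros [Htr H1] Hs. apply (derive_nonneg_le t (fun s => rate (t s) (w s) * (1 - t s))); [lra| |].
- intros x Hx. apply (traj_t_derive b w t x Htr). lra.
- intros x Hx. assert (Hxb : x < b) by lra. destruct (Htr x Hxb) as (Ht & _).
  apply Rmult_le_pos; [left; now apply rate_pos|]. specialize (H1 x Hxb). lra.
Qed.

Lemma tangential_w_lt (b : R) (w t : R -> R) (s u : R) : tangential b w t -> s < u < b -> w u < w s.
Proof.
intros [Htr H1] Hs.
assert (- w s < - w u); [|lra].
apply (derive_pos_lt (fun s => - w s) (fun s => - (t s - 1))); [lra| |].
- intros x Hx. apply (is_derive_opp (K := R_AbsRing) w). apply Htr. lra.
- intros x Hx. assert (t x < 1) by (apply H1; lra). lra.
Qed.

Lemma tangential_w_inj (b : R) (w t : R -> R) (s u : R) : tangential b w t -> s < b -> u < b -> w s = w u -> s = u.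
Proof.
intros H Hs Hu E. destruct (Rtotal_order s u) as [Hlt|[Heq|Hlt]]; [|assumption|].
- generalize (tangential_w_lt b w t s u H). lra.
- generalize (tangential_w_lt b w t u s H). lra.
Qed.

Lemma tangential_stress_lt (b : R) (w t : R -> R) (s u : R) :
  tangential b w t -> s < u < b -> stress (t s) (w s) < stress (t u) (w u).
Proof.
intros [Htr H1] Hs.
apply (derive_pos_lt (fun s => stress (t s) (w s)) (fun s => M * ((1 - t s) * growth (t s)))); [lra| |].
- intros x Hx. apply Htr. lra.
- intros x Hx. assert (Hxb : x < b) by lra. destruct (Htr x Hxb) as (Ht & _).
  specialize (H1 x Hxb). generalize M_12 (growth_bounds _ Ht); intros HM HG.
  apply Rmult_lt_0_compat; [lra|]. apply Rmult_lt_0_compat; lra.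
Qed.

(** Because [t] is nondecreasing, its value at [s1] bounds it from below afterwards; the clamp is
    inactive and the theory of the clamped system applies. *)
Lemma tangential_clamped (b : R) (w t : R -> R) (a s1 s2 : R) :
  tangential b w t -> s2 < b -> a <= t s1 ->
  clamped_solution a s1 s2 w (fun s => stress (t s) (w s)) t.
Proof.
intros H Hb Ha s Hs. assert (Hsb : s < b) by lra.
assert (t s1 <= t s) by (apply (tangential_t_le b w t s1 s H); lra).
destruct H as [Htr H1]. specialize (H1 s Hsb). destruct (Htr s Hsb) as (Ht & Dw & DT).
split; [|split; assumption]. split; [lra|]. split; right; lra.
Qed.

Lemma is_derive_shift (f : R -> R) (c s l : R) : is_derive f (s + c) l -> is_derive (fun s => f (s + c)) s l.
Proof.
intros H. replace l with (scal 1 l) by (unfold scal; simpl; unfold mult; simpl; ring).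
apply (is_derive_comp f (fun s => s + c)); [assumption|]. auto_derive; [trivial|ring].
Qed.

Lemma tangential_shift (b : R) (w t : R -> R) (c : R) :
  tangential b w t -> tangential (b - c) (fun s => w (s + c)) (fun s => t (s + c)).
Proof.
intros [Htr H1]. split.
- intros s Hs. destruct (Htr (s + c)) as (Ht & Dw & DT); [lra|].
  split; [assumption|]. split.
  + now apply is_derive_shift.
  + now apply (is_derive_shift (fun s => stress (t s) (w s))).
- intros s Hs. apply H1. lra.
Qed.

(** The common value of [t] at [s0] serves as the clamp for both trajectories. It bounds [t] from
    below only after [s0], hence the restriction to [s0 <= u]. *)
Lemma tangential_forward_unique (b b' : R) (w t w' t' : R -> R) (s0 u : R) :
  tangential b w t -> tangential b' w' t' -> w s0 = w' s0 -> t s0 = t' s0 -> s0 <= u -> u < b -> u < b' ->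
  w u = w' u /\ t u = t' u.
Proof.
intros H H' Ew Et Hu Hb Hb'.
destruct (proj1 H s0) as (Ht & _); [lra|].
assert (t s0 < 1) by (apply (proj2 H); lra).
destruct (clamped_unique (t s0) s0 u s0 w (fun s => stress (t s) (w s)) t w' (fun s => stress (t' s) (w' s)) t') with (s := u)
  as [E1 E2]; try lra.
- apply (tangential_clamped b); [assumption|assumption|lra].
- apply (tangential_clamped b'); [assumption|assumption|lra].
- now rewrite Et, Ew.
- split; [assumption|]. rewrite <- E1 in E2. apply stress_inj_t with (w u); [| |assumption].
  + apply (proj1 H). lra. + apply (proj1 H'). lra.
Qed.


(** * Trajectories whose stress vanishes at [-oo] *)

Definition stress_free (w t : R -> R) : Prop :=
  forall eps, 0 < eps -> exists s0, forall s, s < s0 -> Rabs (stress (t s) (w s)) < eps.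

Lemma stress_inj_w (t w1 w2 : R) : 0 < t -> stress t w1 = stress t w2 -> w1 = w2.
Proof.
intros Ht E. assert (HM := M_12). destruct (Rtotal_order w1 w2) as [H|[H|H]]; [|assumption|].
- generalize (stress_gap_w t t w1 w2). intros K. assert (M * (w2 - w1) <= 0) by lra. nra.
- generalize (stress_gap_w t t w2 w1). intros K. assert (M * (w1 - w2) <= 0) by lra. nra.
Qed.

Lemma traj_const_w (b : R) (w t : R -> R) (s u : R) :
  traj b w t -> (forall x, x < b -> t x = 1) -> s <= u < b -> w s = w u.
Proof.
intros Htr H1 Hsu. destruct (Req_dec s u) as [->|Hn]; [reflexivity|].
destruct (mvt w (fun x => t x - 1) s u) as (c & Hc & E); [lra| |].
- intros x Hx. apply Htr. lra.
- rewrite H1 in E by lra. lra.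
Qed.

(* If [t > 1], then [t] stays away from 1 as [s -> -oo], so the stress grows at least linearly there. *)
Lemma stress_free_tangential (b : R) (w t : R -> R) :
  traj b w t -> stress_free w t -> stress 1 0 = 0 ->
  (forall s, s < b -> t s < 1) \/ (forall s, s < b -> w s = 0).
Proof.
intros Htr Hfree Hnat.
destruct (Rtotal_order (t (b - 1)) 1) as [H|[H|H]].
- left. intros s Hs. apply (traj_t_side b w t (b - 1) s Htr); lra.
(* Here [w] is constant, so the stress is constant too and equals its limit 0; [stress 1 0 = 0] and
   injectivity in [w] give [w = 0]. *)
- right. assert (H1 : forall s, s < b -> t s = 1).
  { intros s Hs. apply (traj_t_eq_1 b w t (b - 1) s Htr); lra. }
  intros s Hs. apply (stress_inj_w 1); [lra|]. rewrite Hnat.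
  destruct (Req_dec (stress 1 (w s)) 0) as [|Hn]; [assumption|exfalso].
  destruct (Hfree (Rabs (stress 1 (w s)))) as (s0 & Hs0); [now apply Rabs_pos_lt|].
  assert (K1 : Rmin s s0 <= s) by apply Rmin_l. assert (K2 : Rmin s s0 <= s0) by apply Rmin_r.
  specialize (Hs0 (Rmin s s0 - 1)). rewrite H1 in Hs0 by lra.
  rewrite (traj_const_w b w t (Rmin s s0 - 1) s Htr H1) in Hs0 by lra.
  specialize (Hs0 ltac:(lra)). lra.
- exfalso. set (s1 := b - 1) in *. assert (Hs1 : s1 < b) by (unfold s1; lra).
  assert (Hgt : forall s, s < b -> 1 < t s).
  { intros s Hs. now apply (traj_t_side b w t s1 s Htr). }
  assert (Hmono : forall s, s <= s1 -> t s1 <= t s).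
  { intros s Hs. assert (- t s <= - t s1); [|lra].
    apply (derive_nonneg_le (fun s => - t s) (fun s => - (rate (t s) (w s) * (1 - t s)))); [lra| |].
    - intros x Hx. apply (is_derive_opp (K := R_AbsRing) t). apply (traj_t_derive b w t x Htr). lra.
    - intros x Hx. assert (Hx1 := Hgt x ltac:(lra)). assert (Hr := rate_pos (t x) (w x) ltac:(lra)). nra. }
  destruct (Hfree 1) as (s0 & Hs0); [lra|].
  set (d := t s1 - 1) in *. assert (Hd : 0 < d) by (unfold d; lra).
  set (T1 := stress (t s1) (w s1)).
  (* Going back a time of at least [(Rabs T1 + 1) / d], with the stress falling forward at rate at
     least [d], gives a stress of at least [T1 + Rabs T1 + 1 >= 1] at [s]. *)
  set (s := Rmin s0 s1 - 1 - (Rabs T1 + 1) / d).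
  assert (K1 : Rmin s0 s1 <= s0) by apply Rmin_l. assert (K2 : Rmin s0 s1 <= s1) by apply Rmin_r.
  assert (K3 : 0 < (Rabs T1 + 1) / d) by (apply Rdiv_lt_0_compat; [generalize (Rabs_pos T1)|]; lra).
  assert (Hss : s < s1) by (unfold s; lra).
  destruct (mvt (fun s => stress (t s) (w s)) (fun s => M * ((1 - t s) * growth (t s))) s s1 Hss) as (c & Hc & E).
  { intros x Hx. apply Htr. lra. }
  assert (Htc := Hmono c ltac:(lra)). assert (HG := growth_bounds (t c) ltac:(lra)).
  assert (HM := M_12). fold T1 in E.
  assert (Hq : M * ((1 - t c) * growth (t c)) <= - d).
  { assert (d <= (t c - 1) * growth (t c)) by (unfold d; nra).
    assert (1 * ((t c - 1) * growth (t c)) <= M * ((t c - 1) * growth (t c))) by (apply Rmult_le_compat_r; lra). lra. }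
  assert (Hlin : Rabs T1 + 1 <= d * (s1 - s)).
  { replace (Rabs T1 + 1) with (d * ((Rabs T1 + 1) / d)) by (field; lra).
    apply Rmult_le_compat_l; [lra|]. unfold s. lra. }
  assert (M * ((1 - t c) * growth (t c)) * (s1 - s) <= - d * (s1 - s)) by (apply Rmult_le_compat_r; lra).
  assert (Hs := Hs0 s ltac:(unfold s; lra)). apply Rabs_def2 in Hs.
  generalize (Rle_abs (- T1)). rewrite Rabs_Ropp. lra.
Qed.

Definition cavity (b : R) (w t : R -> R) : Prop := tangential b w t /\ stress_free w t.

(** Before [s1] one has [t <= t s1 < 1], so the slope of [w] is at most the negative constant
    [t s1 - 1]. *)
Lemma tangential_w_unbounded (b : R) (w t : R -> R) (A : R) :
  tangential b w t -> exists s0, s0 < b /\ forall s, s <= s0 -> A < w s.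
Proof.
intros H. set (s1 := b - 1). assert (Hs1 : s1 < b) by (unfold s1; lra).
set (d := 1 - t s1). assert (Hd : 0 < d) by (unfold d; generalize (proj2 H s1 Hs1); lra).
exists (s1 - (Rabs (A - w s1) + 1) / d).
assert (Hq : 0 < (Rabs (A - w s1) + 1) / d) by (apply Rdiv_lt_0_compat; [generalize (Rabs_pos (A - w s1))|]; lra).
split; [lra|]. intros s Hs.
destruct (mvt w (fun x => t x - 1) s s1) as (c & Hc & E); [lra| |].
- intros x Hx. apply (proj1 H). lra.
- assert (t c <= t s1) by (apply (tangential_t_le b w t c s1 H); lra).
  assert ((t c - 1) * (s1 - s) <= - d * (s1 - s)) by (apply Rmult_le_compat_r; unfold d; lra).
  assert (Rabs (A - w s1) + 1 <= d * (s1 - s)).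
  { replace (Rabs (A - w s1) + 1) with (d * ((Rabs (A - w s1) + 1) / d)) by (field; lra).
    apply Rmult_le_compat_l; lra. }
  generalize (Rle_abs (A - w s1)). lra.
Qed.

(** Once the stress is below 1 and [w > 1 - k 1], a volume of at least 1 would make the stress too
    large. So [t * exp ((M + 1) * w) < 1], and [w > / e] turns this into [t < e]. *)
Lemma cavity_t_small (b : R) (w t : R -> R) (e : R) :
  cavity b w t -> 0 < e -> exists s0, s0 < b /\ forall s, s <= s0 -> t s < e.
Proof.
intros [H Hfree] He. destruct (Hfree 1) as (s1 & Hs1); [lra|].
destruct (tangential_w_unbounded b w t (Rmax (1 - k 1) (/ e)) H) as (s2 & Hs2 & Hw).
exists (Rmin (s1 - 1) s2).
assert (K1 : Rmin (s1 - 1) s2 <= s1 - 1) by apply Rmin_l. assert (K2 : Rmin (s1 - 1) s2 <= s2) by apply Rmin_r.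
split; [lra|]. intros s Hs.
assert (Hws := Hw s ltac:(lra)). assert (Hss := Hs1 s ltac:(lra)). apply Rabs_def2 in Hss.
assert (Hw1 := Rle_lt_trans _ _ _ (Rmax_l _ _) Hws). assert (Hw2 := Rle_lt_trans _ _ _ (Rmax_r _ _) Hws).
destruct (proj1 H s) as (Ht & _); [lra|].
assert (Hwp : 0 < w s) by (apply Rlt_trans with (2 := Hw2); now apply Rinv_0_lt_compat).
assert (HM := M_12).
assert (HJ : vol (t s) (w s) < 1).
{ apply Rnot_le_lt. intros Hge. assert (k 1 <= k (vol (t s) (w s))) by (apply k_le; lra).
  unfold stress in Hss. assert (0 < t s ^ m) by (now apply pow_lt).
  assert (1 * w s <= M * w s) by (apply Rmult_le_compat_r; lra). lra. }
unfold vol in HJ.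
assert (Hexp : w s <= exp ((M + 1) * w s)).
{ generalize (exp_ineq1_le ((M + 1) * w s)). intros X.
  assert (1 * w s <= M * w s) by (apply Rmult_le_compat_r; lra). lra. }
assert (t s * / e < 1).
{ apply Rle_lt_trans with (2 := HJ). apply Rmult_le_compat_l; lra. }
apply Rmult_lt_reg_r with (/ e); [now apply Rinv_0_lt_compat|]. rewrite Rinv_r by lra. assumption.
Qed.

(** A trajectory seen over the [w] axis: dividing the derivative of the stress by [w' = t - 1]
    leaves [- M * growth t]. The bound [/ 4] is the one of [growth_small]. *)
Definition stress_graph (W : R) (th : R -> R) : Prop :=
  (forall x, W < x -> 0 < th x <= / 4 /\
     is_derive (fun x => stress (th x) x) x (- (M * growth (th x)))) /\
  (forall eps, 0 < eps -> exists X, forall x, X < x -> Rabs (stress (th x) x) < eps).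

(** On [s < s0] the map [w] decreases strictly and takes every value above [w s0]; the graph is the
    stress composed with the inverse [sg]. The last two clauses carry equality of graphs back to
    trajectories. *)
Lemma cavity_graph (b : R) (w t : R -> R) : cavity b w t ->
  exists W th s0, s0 < b /\ stress_graph W th /\
    (forall x, W < x -> exists s, s < s0 /\ w s = x) /\
    (forall s, s < s0 -> W < w s /\ th (w s) = t s).
Proof.
intros Hc. assert (H := proj1 Hc).
destruct (cavity_t_small b w t (/ 4) Hc) as (s0 & Hs0 & Hsmall); [lra|].
assert (Hsol : forall x, exists s, w s0 < x -> s < s0 /\ w s = x).
{ intros x. destruct (Rlt_le_dec (w s0) x) as [Hx|Hx]; [|exists 0; lra].
  destruct (tangential_w_unbounded b w t x H) as (s1 & Hs1 & Hw1).
  assert (K1 : Rmin s1 s0 <= s1) by apply Rmin_l. assert (K2 : Rmin s1 s0 <= s0) by apply Rmin_r.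
  specialize (Hw1 _ K1).
  destruct (IVT_interval w (Rmin s1 s0) s0 x) as (s & Hs & E); [assumption| | |].
  - intros u Hu. exact (is_derive_continuous _ _ _ (proj1 (proj2 (proj1 H u ltac:(lra))))).
  - rewrite Rmin_right, Rmax_left; lra.
  - exists s. intros _. split; [|assumption]. destruct (Req_dec s s0); [subst; lra|lra]. }
destruct (choice _ Hsol) as [sg Hsg].
exists (w s0), (fun x => t (sg x)), s0.
split; [assumption|]. split; [split|split].
- intros x Hx. destruct (Hsg x Hx) as (Hlt & Ex).
  destruct (proj1 H (sg x)) as (Ht & Dw & DT); [lra|].
  split; [specialize (Hsmall (sg x)); lra|].
  assert (Hinv : locally x (fun y => w (sg y) = y)).
  { generalize (locally_gt x _ Hx). apply filter_imp. intros y Hy. now apply Hsg. }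
  (* The values of [w] at [sg x - e] and [sg x + e] bracket [x], and monotonicity traps [sg y] for
     [y] between them. The bound by half of [s0 - sg x] keeps these [y] above [w s0], where [sg] is
     an inverse. *)
  assert (Hcont : continuous sg x).
  { apply continuous_eps. intros eps He.
    assert (Hmin : Rmin (eps / 2) ((s0 - sg x) / 2) <= eps / 2) by apply Rmin_l.
    assert (Hmin' : Rmin (eps / 2) ((s0 - sg x) / 2) <= (s0 - sg x) / 2) by apply Rmin_r.
    set (e := Rmin (eps / 2) ((s0 - sg x) / 2)) in *.
    assert (He0 : 0 < e) by (apply Rmin_glb_lt; lra).
    assert (D1 := tangential_w_lt b w t (sg x) (sg x + e) H ltac:(lra)).
    assert (D2 := tangential_w_lt b w t (sg x - e) (sg x) H ltac:(lra)).
    assert (D3 := tangential_w_lt b w t (sg x + e) s0 H ltac:(lra)).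
    rewrite Ex in D1, D2.
    destruct (filter_and _ _ (locally_gt x _ D1) (locally_lt x _ D2)) as [d Hd].
    exists d. split; [apply cond_pos|]. intros y Hy. destruct (Hd y Hy) as (Y1 & Y2).
    destruct (Hsg y ltac:(lra)) as (Hlty & Ey).
    assert (sg x - e < sg y).
    { apply Rnot_le_lt. intros [Hle|Hle].
      - generalize (tangential_w_lt b w t (sg y) (sg x - e) H ltac:(lra)). lra.
      - rewrite <- Hle in Y2. lra. }
    assert (sg y < sg x + e).
    { apply Rnot_le_lt. intros [Hle|Hle].
      - generalize (tangential_w_lt b w t (sg x + e) (sg y) H ltac:(lra)). lra.
      - rewrite Hle in Y1. lra. }
    apply Rabs_def1; lra. }
  assert (Hne : t (sg x) - 1 <> 0) by (generalize (proj2 H (sg x)); lra).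
  assert (Dsg := derive_inverse w sg x _ Hinv Hcont Dw Hne).
  apply (is_derive_ext_loc (fun y => stress (t (sg y)) (w (sg y)))).
  { revert Hinv. apply filter_imp. intros y ->. reflexivity. }
  replace (- (M * growth (t (sg x)))) with (scal (/ (t (sg x) - 1)) (M * ((1 - t (sg x)) * growth (t (sg x)))))
    by (unfold scal; simpl; unfold mult; simpl; field; assumption).
  apply (is_derive_comp (fun s => stress (t s) (w s)) sg); assumption.
- intros eps He. destruct (proj2 Hc eps He) as (s1 & Hs1).
  assert (K1 : Rmin (s1 - 1) s0 <= s1 - 1) by apply Rmin_l. assert (K2 : Rmin (s1 - 1) s0 <= s0) by apply Rmin_r.
  exists (w (Rmin (s1 - 1) s0)). intros x Hx.
  assert (Hx0 : w s0 < x).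
  { destruct K2 as [K2|K2]; [|rewrite <- K2; assumption].
    generalize (tangential_w_lt b w t _ _ H (conj K2 Hs0)). lra. }
  destruct (Hsg x Hx0) as (Hlt & Ex). rewrite <- Ex at 2. apply Hs1.
  assert (sg x < Rmin (s1 - 1) s0); [|lra].
  apply Rnot_le_lt. intros [Hle|Hle].
  + generalize (tangential_w_lt b w t _ _ H (conj Hle (Rlt_trans _ _ _ Hlt Hs0))). lra.
  + rewrite Hle in Hx. lra.
- intros x Hx. exists (sg x). now apply Hsg.
- intros s Hs. assert (Hws := tangential_w_lt b w t s s0 H (conj Hs Hs0)). split; [assumption|].
  destruct (Hsg (w s) Hws) as (Hlt & E). f_equal. apply (tangential_w_inj b w t _ _ H); lra.
Qed.

(* Comparing one graph with a horizontal translate of the other: where the translate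
   lies above, it lies above by less than [M * eta], and monotonicity of [k] orders the
   values of [th]. *)
Lemma stress_graph_le (W1 W2 : R) (th1 th2 : R -> R) (x0 : R) :
  stress_graph W1 th1 -> stress_graph W2 th2 -> W1 < x0 -> W2 < x0 ->
  stress (th1 x0) x0 <= stress (th2 x0) x0.
Proof.
intros [G1 L1] [G2 L2] H1 H2. assert (HM := M_12).
apply Rnot_lt_le. intros Hlt.
set (D := stress (th1 x0) x0 - stress (th2 x0) x0).
assert (HD : 0 < D) by (unfold D; lra).
set (eta := 2 * D / M). assert (Heta : 0 < eta) by (apply Rdiv_lt_0_compat; lra).
assert (HMeta : M * eta = 2 * D) by (unfold eta; field; lra).
set (H := fun x => stress (th2 x) x - stress (th1 (x + eta)) (x + eta)).
set (dH := fun x => - (M * growth (th2 x)) - - (M * growth (th1 (x + eta)))).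
assert (DH : forall x, x0 <= x -> is_derive H x (dH x)).
{ intros x Hx. unfold H, dH.
  apply (is_derive_minus (K := R_AbsRing) (fun x => stress (th2 x) x) (fun x => stress (th1 (x + eta)) (x + eta))).
  - apply G2. lra.
  - apply (is_derive_shift (fun x => stress (th1 x) x)). apply G1. lra. }
(* Over the length [eta] the first graph falls by [2 * D * growth (th1 c)], which is less than [D].
   The translate thus still lies above the second graph at [x0], that is [H x0 < 0]. *)
destruct (mvt (fun x => stress (th1 x) x) (fun x => - (M * growth (th1 x))) x0 (x0 + eta)) as (c & Hc & Ec); [lra| |].
{ intros x Hx. apply G1. lra. }
destruct (G1 c ltac:(lra)) as (Hth & _).
assert (HG := growth_small (th1 c) Hth). assert (HGp := growth_bounds (th1 c) (proj1 Hth)).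
replace (x0 + eta - x0) with eta in Ec by ring.
assert (HGM : 0 < M * growth (th1 c)) by (apply Rmult_lt_0_compat; lra).
destruct (Rle_lt_dec 0 (H x0)) as [H0|H0].
- unfold H in H0. assert (M * growth (th1 c) * eta < / 2 * M * eta) by (apply Rmult_lt_compat_r; lra).
  unfold D in *. lra.
(* Wherever [H] is at or above the level [H x0], it is nonincreasing, so it never exceeds this
   negative level; but both stresses tend to 0 at infinity. *)
- assert (Hle : forall x, x0 <= x -> H x <= H x0).
  { intros x Hx. apply (barrier H dH x0 x (H x0)); [assumption| | |lra].
    - intros y Hy. apply DH. lra.
    - intros y Hy Hge. unfold dH.
      destruct (G2 y ltac:(lra)) as (Hp2 & _). destruct (G1 (y + eta) ltac:(lra)) as (Hp1 & _).
      assert (th1 (y + eta) <= th2 y).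
      { apply Rnot_lt_le. intros Hlt'.
        assert (K := stress_gap_w (th2 y) (th1 (y + eta)) y (y + eta) ltac:(lra) ltac:(lra)).
        replace (y + eta - y) with eta in K by ring.
        assert (0 < M * growth (th1 c) * eta) by (apply Rmult_lt_0_compat; lra).
        unfold H in Hge. unfold D in *. lra. }
      assert (growth (th1 (y + eta)) <= growth (th2 y)) by (apply growth_le; lra).
      assert (M * growth (th1 (y + eta)) <= M * growth (th2 y)) by (apply Rmult_le_compat_l; lra). lra. }
  destruct (L1 (- H x0 / 2)) as (X1 & HX1); [lra|]. destruct (L2 (- H x0 / 2)) as (X2 & HX2); [lra|].
  set (x := Rmax x0 (Rmax X1 X2) + 1).
  assert (x0 < x) by (unfold x; generalize (Rmax_l x0 (Rmax X1 X2)); lra).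
  assert (K := Rmax_r x0 (Rmax X1 X2)). assert (Ka := Rmax_l X1 X2). assert (Kb := Rmax_r X1 X2).
  specialize (HX1 (x + eta) ltac:(unfold x; lra)). specialize (HX2 x ltac:(unfold x; lra)).
  apply Rabs_def2 in HX1. apply Rabs_def2 in HX2.
  specialize (Hle x ltac:(lra)). unfold H at 1 in Hle. lra.
Qed.

Lemma stress_graph_unique (W1 W2 : R) (th1 th2 : R -> R) (x : R) :
  stress_graph W1 th1 -> stress_graph W2 th2 -> W1 < x -> W2 < x -> th1 x = th2 x.
Proof.
intros G1 G2 H1 H2. apply (stress_inj_t _ _ x).
- apply G1. assumption. - apply G2. assumption.
- apply Rle_antisym; eapply stress_graph_le; eassumption.
Qed.

(** Far back in [s] both trajectories lie on the same graph, so each early point of the first is a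
    point of the second at some other time. Forward uniqueness from such a pair gives a translation,
    valid after the starting time. *)
Lemma cavity_unique (b : R) (w t w' t' : R -> R) :
  cavity b w t -> (forall b', cavity b' w' t') ->
  exists c, forall s, s < b -> w s = w' (s + c).
Proof.
intros C C'. assert (Hh := proj1 C). assert (Hh' := fun b' => proj1 (C' b')).
destruct (cavity_graph b w t C) as (W1 & th1 & s1 & Hs1 & G1 & _ & F1).
destruct (cavity_graph 0 w' t' (C' 0)) as (W2 & th2 & s2 & Hs2 & G2 & E2 & F2).
destruct (tangential_w_unbounded b w t W2 Hh) as (s3 & Hs3 & Hw3).
set (sa := Rmin (s1 - 1) s3).
assert (Ka1 : sa <= s1 - 1) by apply Rmin_l. assert (Ka2 : sa <= s3) by apply Rmin_r.
assert (Hmatch : forall s, s <= sa -> exists s', s' < s2 /\ w' s' = w s /\ t' s' = t s).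
{ intros s Hs. destruct (F1 s ltac:(lra)) as (HW1 & Et1). assert (HW2 := Hw3 s ltac:(lra)).
  destruct (E2 (w s) HW2) as (s' & Hs' & Ew). exists s'. split; [assumption|]. split; [assumption|].
  destruct (F2 s' Hs') as (_ & Et2). rewrite <- Et1, <- Et2, Ew. symmetry.
  now apply (stress_graph_unique W1 W2). }
assert (Hfwd : forall s s' u, s <= sa -> w' s' = w s -> t' s' = t s -> s <= u -> u < b -> w u = w' (u + (s' - s))).
{ intros s s' u Hs Ew Et Hu Hb.
  set (b' := s' + (u - s) + 1).
  apply (tangential_forward_unique b (b' - (s' - s)) w t (fun x => w' (x + (s' - s))) (fun x => t' (x + (s' - s))) s u);
    try assumption.
  - now apply tangential_shift.
  - replace (s + (s' - s)) with s' by ring. now symmetry.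
  - replace (s + (s' - s)) with s' by ring. now symmetry.
  - unfold b'. lra. }
destruct (Hmatch sa ltac:(lra)) as (sa' & Hsa' & Ewa & Eta).
exists (sa' - sa). intros s Hs. destruct (Rle_lt_dec sa s) as [Hle|Hle].
- now apply (Hfwd sa sa' s).
- destruct (Hmatch s ltac:(lra)) as (s' & Hs' & Ew & Et).
  assert (E := Hfwd s s' sa ltac:(lra) Ew Et ltac:(lra) ltac:(lra)).
  (* The translation found from the earlier time [s] must be the one found from [sa], because [w']
     takes the value [w sa] only once. *)
  assert (X : sa + (s' - s) = sa').
  { apply (tangential_w_inj (Rmax (sa + (s' - s)) sa' + 1) w' t'); [apply Hh'| | |congruence].
    - generalize (Rmax_l (sa + (s' - s)) sa'). lra.
    - generalize (Rmax_r (sa + (s' - s)) sa'). lra. }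
  replace (s + (sa' - sa)) with s' by lra. now symmetry.
Qed.

(** * Continuation to the whole line and behaviour at [+oo] *)

Lemma traj_local (s : R) (w t w' t' : R -> R) :
  locally s (fun u => w' u = w u /\ t' u = t u) ->
  0 < t s /\ is_derive w s (t s - 1) /\
    is_derive (fun s => stress (t s) (w s)) s (M * ((1 - t s) * growth (t s))) ->
  0 < t' s /\ is_derive w' s (t' s - 1) /\
    is_derive (fun s => stress (t' s) (w' s)) s (M * ((1 - t' s) * growth (t' s))).
Proof.
intros Hloc (Ht & Dw & DT). destruct (locally_singleton _ _ Hloc) as (Ew & Et). rewrite Et.
split; [assumption|]. split.
- apply (is_derive_ext_loc w); [|assumption]. revert Hloc. apply filter_imp. intros u [-> _]. reflexivity.
- apply (is_derive_ext_loc (fun s => stress (t s) (w s))); [|assumption].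
  revert Hloc. apply filter_imp. intros u [-> ->]. reflexivity.
Qed.

(** The clamped system is solved forward from [s1] with clamp [a = t s1], and then the clamp is
    shown to be inactive: [Hlow] excludes the lower end and [Hup] the upper one, so [tau] is the
    true root of the stress relation. *)
Lemma tangential_extension (b : R) (w t : R -> R) : tangential b w t ->
  exists w' t', (forall b', tangential b' w' t') /\ forall s, s < b -> w' s = w s /\ t' s = t s.
Proof.
intros H. assert (HM := M_12).
set (s1 := b - 2). assert (Hs1 : s1 < b) by (unfold s1; lra).
set (a := t s1). assert (Ha0 : 0 < a) by (apply (proj1 H s1 Hs1)).
assert (Ha1 : a < 1) by (apply (proj2 H s1 Hs1)).
destruct (clamped_solution_exists a (w s1) (stress a (w s1)) s1) as (x & y & tau & Ex & Ey & Hsol); [lra|].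
assert (Hat : forall s, s1 <= s -> clamped a (x s) (y s) (tau s) /\ is_derive x s (tau s - 1) /\
   is_derive y s (M * ((1 - tau s) * growth (tau s)))).
{ intros s Hs. apply (Hsol s). lra. }
(* As [tau <= 1], [x] is nonincreasing and with it [stress a (x s)], while [y] is nondecreasing; the
   two agree at [s1]. *)
assert (Hlow : forall s, s1 <= s -> stress a (x s) <= y s).
{ intros s Hs.
  set (dl := fun u => M * a ^ (m - 1) * 0 + dk (vol a (x u)) * (0 + (M + 1) * a * (tau u - 1)) * exp ((M + 1) * x u)
     + M * (tau u - 1)).
  assert (K : y s1 - stress a (x s1) <= y s - stress a (x s)).
  { apply (derive_nonneg_le (fun u => y u - stress a (x u)) (fun u => M * ((1 - tau u) * growth (tau u)) - dl u)); [assumption| |].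
    - intros u Hu. destruct (Hat u ltac:(lra)) as (_ & Dx & Dy).
      apply (is_derive_minus (K := R_AbsRing) y (fun u => stress a (x u))); [assumption|].
      apply (stress_derive (fun _ => a) x u 0 (tau u - 1)); [assumption| |assumption].
      exact (is_derive_const a u).
    - intros u Hu. destruct (Hat u ltac:(lra)) as (Ct & _). destruct Ct as (Ht & _). unfold dl.
      assert (HG := growth_bounds (tau u) ltac:(lra)).
      assert (Hp : 0 < dk (vol a (x u)) * exp ((M + 1) * x u)).
      { apply Rmult_lt_0_compat; [apply dk_pos, vol_pos; assumption|apply exp_pos]. }
      set (q := dk (vol a (x u)) * exp ((M + 1) * x u)) in *.
      assert (P1 : 0 <= (1 - tau u) * growth (tau u)) by (apply Rmult_le_pos; lra).
      assert (P2 : 0 <= M * ((1 - tau u) * growth (tau u))) by (apply Rmult_le_pos; lra).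
      assert (P3 : 0 <= M * (1 - tau u)) by (apply Rmult_le_pos; lra).
      assert (P4 : 0 <= q * ((M + 1) * a * (1 - tau u))).
      { apply Rmult_le_pos; [lra|]. apply Rmult_le_pos; [|lra]. apply Rmult_le_pos; lra. }
      replace (dk (vol a (x u)) * (0 + (M + 1) * a * (tau u - 1)) * exp ((M + 1) * x u))
        with (- (q * ((M + 1) * a * (1 - tau u)))) by (unfold q; ring).
      lra. }
  rewrite Ex, Ey in K. lra. }
assert (Hup : forall s, s1 <= s -> y s < stress 1 (x s)).
{ intros s Hs. apply Rnot_le_lt. intros Hle.
  assert (Hstart : y s1 < stress 1 (x s1)) by (rewrite Ex, Ey; apply stress_lt_t; lra).
  destruct (IVT_interval (fun u => stress 1 (x u) - y u) s1 s 0) as (c & Hc & Ec); [assumption| | |].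
  - intros u Hu. destruct (Hat u ltac:(lra)) as (_ & Dx & Dy).
    apply (continuous_minus (V := R_NormedModule)).
    + apply (continuous_comp x (stress 1)); [exact (is_derive_continuous _ _ _ Dx)|]. apply stress_continuous_w. lra.
    + exact (is_derive_continuous _ _ _ Dy).
  - rewrite Rmin_right, Rmax_left; lra.
  - (* at [c] the solution would meet an affine equilibrium *)
    destruct (clamped_unique a s1 c c x y tau (fun _ => x c) (fun _ => y c) (fun _ => 1)) with (s := s1) as [U1 U2];
      try lra.
    + intros u Hu. apply Hat. lra.
    + intros u Hu. split; [|split].
      * split; [lra|]. split; [right; lra|left; reflexivity].
      * replace (1 - 1) with 0 by ring. exact (is_derive_const (x c) u).
      * replace (M * ((1 - 1) * growth 1)) with 0 by ring. exact (is_derive_const (y c) u).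
    + rewrite U1, U2 in Hstart. lra. }
assert (Hroot : forall s, s1 <= s -> 0 < tau s /\ tau s < 1 /\ stress (tau s) (x s) = y s).
{ intros s Hs. destruct (Hat s Hs) as ((Ht & C1 & C2) & _). specialize (Hlow s Hs). specialize (Hup s Hs).
  assert (Hlt : tau s <> 1).
  { intros E1. rewrite E1 in C1. destruct C1 as [C1|C1]; lra. }
  split; [lra|]. split; [lra|]. destruct C2 as [C2|C2]; [lra|].
  destruct C1 as [C1|C1]; [rewrite C1 in *; lra|lra]. }
assert (Hcont : forall s, s1 < s -> 0 < tau s /\ is_derive x s (tau s - 1) /\
    is_derive (fun s => stress (tau s) (x s)) s (M * ((1 - tau s) * growth (tau s)))).
{ intros s Hs. destruct (Hroot s ltac:(lra)) as (R1 & R2 & R3). destruct (Hat s ltac:(lra)) as (_ & Dx & Dy).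
  split; [assumption|]. split; [assumption|]. apply (is_derive_ext_loc y); [|assumption].
  generalize (locally_gt s s1 Hs). apply filter_imp. intros u Hu. symmetry. apply Hroot. lra. }
assert (Hagree : forall s, s1 <= s < b -> x s = w s /\ tau s = t s).
{ intros s Hs.
  destruct (clamped_unique a s1 s s1 w (fun s => stress (t s) (w s)) t x y tau) with (s := s) as [U1 U2]; try lra.
  - apply (tangential_clamped b); [assumption|lra|unfold a; lra].
  - intros u Hu. apply Hat. lra.
  - fold a. lra.
  - split; [now symmetry|]. destruct (Hroot s ltac:(lra)) as (R1 & R2 & R3).
    apply (stress_inj_t _ _ (x s)); [assumption| |].
    + apply (proj1 H). lra. + rewrite R3, <- U1. now symmetry. }
(* The old and the new trajectory agree on [[b - 2, b)]. Switching in the middle of the overlap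
   leaves every point a neighbourhood on which the glued functions coincide with one of the two. *)
set (cut := b - 1).
exists (fun s => if Rlt_dec s cut then w s else x s), (fun s => if Rlt_dec s cut then t s else tau s).
assert (Hl : forall s, s < b -> (if Rlt_dec s cut then w s else x s) = w s /\ (if Rlt_dec s cut then t s else tau s) = t s).
{ intros s Hs. destruct (Rlt_dec s cut) as [Hc|Hc]; [tauto|]. apply Hagree. unfold s1, cut in *. lra. }
assert (Hr : forall s, s1 < s -> (if Rlt_dec s cut then w s else x s) = x s /\ (if Rlt_dec s cut then t s else tau s) = tau s).
{ intros s Hs. destruct (Rlt_dec s cut) as [Hc|Hc]; [|tauto].
  destruct (Hagree s) as [E1 E2]; [unfold cut in *; lra|]. split; now symmetry. }
split; [|exact Hl]. intros b'. split.
- intros s _. destruct (Rlt_le_dec s b) as [Hs|Hs].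
  + apply (traj_local s w t (fun s => if Rlt_dec s cut then w s else x s) (fun s => if Rlt_dec s cut then t s else tau s)); [|now apply (proj1 H)].
    generalize (locally_lt s b Hs). apply filter_imp. exact Hl.
  + apply (traj_local s x tau (fun s => if Rlt_dec s cut then w s else x s) (fun s => if Rlt_dec s cut then t s else tau s)); [|apply Hcont; lra].
    generalize (locally_gt s s1 ltac:(lra)). apply filter_imp. exact Hr.
- intros s _. destruct (Rlt_le_dec s b) as [Hs|Hs].
  + destruct (Hl s Hs) as [_ ->]. now apply (proj2 H).
  + destruct (Hr s ltac:(lra)) as [_ ->]. apply Hroot. lra.
Qed.

Lemma cavity_limit (w t : R -> R) :
  (forall b, cavity b w t) -> stress 1 0 = 0 ->
  exists l, 0 < l /\ (forall s, l < w s) /\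
    (forall eps, 0 < eps -> exists s0, forall s, s0 < s -> w s < l + eps) /\
    (forall eps, 0 < eps -> exists s0, forall s, s0 < s -> 1 - eps < t s).
Proof.
intros C Hnat. assert (Hh := fun b => proj1 (C b)). assert (HM := M_12).
assert (Hinc : forall s u, s < u -> stress (t s) (w s) < stress (t u) (w u)).
{ intros s u Hsu. apply (tangential_stress_lt (u + 1)); [apply Hh|lra]. }
assert (Hdec : forall s u, s < u -> w u < w s).
{ intros s u Hsu. apply (tangential_w_lt (u + 1) w t); [apply Hh|lra]. }
assert (Ht1 : forall s, 0 < t s < 1).
{ intros s. split; [apply (proj1 (Hh (s + 1)))|apply (proj2 (Hh (s + 1)))]; lra. }
(* The stress increases strictly from its limit 0 at [-oo]. *)
assert (HT0 : 0 < stress (t 0) (w 0)).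
{ apply Rnot_le_lt. intros Hle. assert (H1 := Hinc (-1) 0 ltac:(lra)).
  destruct (proj2 (C 0) (- stress (t (-1)) (w (-1)))) as (s0 & Hs0); [lra|].
  assert (K1 := Rmin_l s0 (-1)). assert (K2 := Rmin_r s0 (-1)).
  specialize (Hs0 (Rmin s0 (-1) - 1) ltac:(lra)). apply Rabs_def2 in Hs0.
  generalize (Hinc (Rmin s0 (-1) - 1) (-1) ltac:(lra)). lra. }
(* This [e] bounds [w] from below: with [w < e] and [t < 1], the stress would be below [stress 1 e],
   hence below its value at time 0, although it increases. *)
assert (exists e, 0 < e /\ stress 1 e < stress (t 0) (w 0)) as (e & He & Hse).
{ destruct (proj1 (continuous_eps (stress 1) 0) (stress_continuous_w 1 0 ltac:(lra)) _ HT0) as (d & Hd & Hde).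
  exists (d / 2). split; [lra|]. specialize (Hde (d / 2)). rewrite Hnat, !Rminus_0_r in Hde.
  specialize (Hde ltac:(rewrite Rabs_pos_eq; lra)). apply Rabs_def2 in Hde. lra. }
assert (Hwe : forall s, e <= w s).
{ intros s. apply Rnot_lt_le. intros Hlt. set (u := Rmax s 0 + 1).
  assert (K1 := Rmax_l s 0). assert (K2 := Rmax_r s 0).
  assert (w u < w s) by (apply Hdec; unfold u; lra).
  assert (stress (t 0) (w 0) < stress (t u) (w u)) by (apply Hinc; unfold u; lra).
  generalize (stress_gap_w (t u) 1 (w u) e). specialize (Ht1 u). intros K.
  assert (M * (e - w u) <= stress 1 e - stress (t u) (w u)) by (apply K; lra).
  assert (0 < M * (e - w u)) by (apply Rmult_lt_0_compat; lra). lra. }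
destruct (completeness (fun z => exists s, z = - w s)) as (z & Hub & Hlub).
{ exists (- e). intros z (s & ->). specialize (Hwe s). lra. }
{ now exists (- w 0), 0. }
exists (- z). split; [|split; [|split]].
- assert (z <= - e); [|lra]. apply Hlub. intros z' (s & ->). specialize (Hwe s). lra.
- intros s. assert (- w (s + 1) <= z) by (apply Hub; now exists (s + 1)).
  generalize (Hdec s (s + 1) ltac:(lra)). lra.
- intros eps Heps. destruct (classic (exists s0, w s0 < - z + eps)) as [(s0 & Hs0)|Hno].
  + exists s0. intros s Hs. generalize (Hdec s0 s Hs). lra.
  + exfalso. assert (z <= z - eps); [|lra]. apply Hlub. intros z' (s & ->).
    apply Rnot_lt_le. intros Hlt. apply Hno. exists s. lra.
- intros eps Heps. destruct (classic (exists s0, 1 - eps < t s0)) as [(s0 & Hs0)|Hno].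
  + exists s0. intros s Hs. assert (t s0 <= t s) by (apply (tangential_t_le (s + 1) w t); [apply Hh|lra]). lra.
  (* If [t <= 1 - eps] throughout, then [w] falls at rate at least [eps] and is negative at this
     time [s], against [e <= w s]. *)
  + exfalso. set (s := Rabs (w 0) / eps + 1).
    assert (Hs : 0 < s).
    { assert (0 <= Rabs (w 0) / eps) by (apply Rdiv_le_0_compat; [apply Rabs_pos|assumption]). unfold s. lra. }
    destruct (mvt w (fun s => t s - 1) 0 s Hs) as (c & Hc & E).
    { intros u Hu. apply (proj1 (Hh (u + 1))). lra. }
    assert (t c <= 1 - eps) by (apply Rnot_lt_le; intros Hlt; apply Hno; now exists c).
    assert ((t c - 1) * (s - 0) <= - eps * (s - 0)) by (apply Rmult_le_compat_r; lra).
    assert (eps * s = Rabs (w 0) + eps) by (unfold s; field; lra).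
    generalize (Hwe s) (Rle_abs (w 0)). lra.
Qed.

End Trajectories.

(** * Radial solutions *)

Section Radial.

Variable n : nat.
Hypothesis n_23 : n = 2%nat \/ n = 3%nat.
Variables (kappa : R) (h : R -> R).
Hypothesis kappa_pos : 0 < kappa.
Hypothesis hh : compressibility h.

Let m := (n - 1)%nat.
Definition compress (J : R) : R := Derive h J / kappa + (INR n - 1) / INR n.
Definition dcompress (J : R) : R := Derive_n h 2 J / kappa.

Lemma pred_n_12 : m = 1%nat \/ m = 2%nat.
Proof. unfold m. lia. Qed.

Lemma compress_derive (J : R) : 0 < J -> is_derive compress J (dcompress J).
Proof.
intros HJ. destruct (h_convex h hh J HJ) as [Hex _]. unfold compress, dcompress.
simpl in Hex. assert (D := Derive_correct _ _ Hex).
change (Derive (fun x => Derive (fun x => h x) x) J) with (Derive_n h 2 J) in D.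
change (fun x => Derive (fun x => h x) x) with (Derive h) in D.
auto_derive; [now exists (Derive_n h 2 J)|].
rewrite (Derive_eta _ _ _ D). simpl. field. lra.
Qed.

Lemma dcompress_pos (J : R) : 0 < J -> 0 < dcompress J.
Proof. intros HJ. apply Rdiv_lt_0_compat; [|assumption]. now apply (h_convex h hh). Qed.

(** * Partial derivatives of the energy in terms of [stress] *)

Lemma exp_mult_ln (q : R) : 0 < q -> exp ((INR m + 1) * ln q) = q ^ n.
Proof.
intros Hq. unfold m. destruct n_23 as [-> | ->]; simpl.
- replace ((1 + 1) * ln q) with (ln q + ln q) by ring. rewrite exp_plus, exp_ln by assumption. ring.
- replace ((1 + 1 + 1) * ln q) with (ln q + (ln q + ln q)) by ring. rewrite !exp_plus, exp_ln by assumption. ring.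
Qed.

(** Each term carries the factor [q^m]: it is the derivative of the volume in [v_1], and
    [p^m = q^m * (p / q)^m]. The logarithm of the [m] tangential stretches gives [m * ln q]. *)
Lemma partial_1_Phi (v : nat -> R) (p q : R) :
  0 < p -> 0 < q -> v 1%nat = p -> v 2%nat = q -> v 3%nat = q ->
  partial 1 (Phi n kappa h) v = kappa * q ^ m * stress m compress (p / q) (ln q).
Proof.
intros Hp Hq E1 E2 E3. unfold stress, vol. rewrite exp_mult_ln by assumption.
unfold partial. apply is_derive_unique. unfold compress, m, Phi, prod_all, prod_tail.
destruct n_23 as [-> | ->]; simpl; rewrite ?E1, ?E2, ?E3.
- assert (Hpq : 0 < p * q) by (now apply Rmult_lt_0_compat).
  destruct (h_C1 h hh _ Hpq) as [Hex _].
  auto_derive; [repeat match goal with |- _ /\ _ => split end; trivial|].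
  replace (p / q * (q * (q * 1))) with (p * q) by (field; lra). change (Derive (fun x => h x)) with (Derive h). field. lra.
- assert (Hpq : 0 < p * q * q) by (apply Rmult_lt_0_compat; [now apply Rmult_lt_0_compat|assumption]).
  destruct (h_C1 h hh _ Hpq) as [Hex _].
  assert (Hqq : 0 < q * q) by (now apply Rmult_lt_0_compat).
  auto_derive; [repeat match goal with |- _ /\ _ => split end; trivial|].
  replace (p / q * (q * (q * (q * 1)))) with (p * q * q) by (field; lra).
  rewrite ln_mult by assumption. change (Derive (fun x => h x)) with (Derive h). field. lra.
Qed.

(** The power of [v_1] is constant here, hence the correction [- (p / q)^m]; the 1 comes from
    differentiating the logarithm, since the volume divided by [q] is [p * q ^ (n - 2)]. *)
Lemma partial_2_Phi (v : nat -> R) (p q : R) :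
  0 < p -> 0 < q -> v 1%nat = p -> v 2%nat = q -> v 3%nat = q ->
  partial 2 (Phi n kappa h) v =
    kappa * p * q ^ (n - 2) * (stress m compress (p / q) (ln q) - (p / q) ^ m + 1).
Proof.
intros Hp Hq E1 E2 E3. unfold stress, vol. rewrite exp_mult_ln by assumption.
unfold partial. apply is_derive_unique. unfold compress, m, Phi, prod_all, prod_tail.
destruct n_23 as [-> | ->]; simpl; rewrite ?E1, ?E2, ?E3.
- assert (Hpq : 0 < p * q) by (now apply Rmult_lt_0_compat).
  destruct (h_C1 h hh _ Hpq) as [Hex _].
  auto_derive; [repeat match goal with |- _ /\ _ => split end; trivial|].
  replace (p / q * (q * (q * 1))) with (p * q) by (field; lra). change (Derive (fun x => h x)) with (Derive h). field. lra.
- assert (Hpq : 0 < p * q * q) by (apply Rmult_lt_0_compat; [now apply Rmult_lt_0_compat|assumption]).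
  destruct (h_C1 h hh _ Hpq) as [Hex _].
  assert (Hqq : 0 < q * q) by (now apply Rmult_lt_0_compat).
  auto_derive; [repeat match goal with |- _ /\ _ => split end; trivial|].
  replace (p / q * (q * (q * (q * 1)))) with (p * q * q) by (field; lra).
  rewrite ln_mult by assumption. change (Derive (fun x => h x)) with (Derive h). field. lra.
Qed.

Lemma stress_natural : partial 1 (Phi n kappa h) (fun _ => 1) = 0 -> stress m compress 1 0 = 0.
Proof.
intros H. rewrite (partial_1_Phi _ 1 1) in H by (trivial; lra).
rewrite ln_1, pow1, Rmult_1_r in H. replace (1 / 1) with 1 in H by field. nra.
Qed.

Lemma Phi_d_1 (r : R -> R) (x : R) : 0 < Derive r x -> 0 < r x / x ->
  Phi_d n kappa h 1 r x = kappa * (r x / x) ^ m * stress m compress (Derive r x / (r x / x)) (ln (r x / x)).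
Proof. intros Hp Hq. now apply partial_1_Phi. Qed.

Lemma Phi_d_2 (r : R -> R) (x : R) : 0 < Derive r x -> 0 < r x / x ->
  Phi_d n kappa h 2 r x = kappa * Derive r x * (r x / x) ^ (n - 2) *
    (stress m compress (Derive r x / (r x / x)) (ln (r x / x)) - (Derive r x / (r x / x)) ^ m + 1).
Proof. intros Hp Hq. now apply partial_2_Phi. Qed.

Lemma cauchy_stress_eq (r : R -> R) (x : R) : 0 < Derive r x -> 0 < r x / x ->
  cauchy_stress n kappa h r x = kappa * stress m compress (Derive r x / (r x / x)) (ln (r x / x)).
Proof.
intros Hp Hq. unfold cauchy_stress. rewrite Phi_d_1 by assumption.
set (S := stress _ _ _ _). clearbody S. revert Hq. generalize (r x / x). intros q Hq.
unfold m in *. destruct n_23 as [-> | ->]; simpl; field; lra.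
Qed.

(* Logarithmic variables: [x = exp s], [w = ln (r / x)], [t = x r' / r]. *)
Definition log_stretch (r : R -> R) (s : R) : R := ln (r (exp s) / exp s).
Definition stretch_ratio (r : R -> R) (s : R) : R := Derive r (exp s) / (r (exp s) / exp s).

(** The quantity differentiated in the equilibrium equation is [kappa * r^m * stress]. On dividing
    it by [kappa * r^m], the quotient rule cancels the terms containing the stress itself and leaves
    [m * (r' / r) * (1 - t^m)]; passing to [s = ln R] multiplies this by [R]. *)
Lemma radial_solution_traj (c : Rbar) (b : R) (r : R -> R) :
  radial_solution n kappa h c r -> (forall s, s < b -> Rbar_lt (exp s) c) ->
  traj m compress b (log_stretch r) (stretch_ratio r).
Proof.
intros Hr Hbc s Hs. assert (Hx := exp_pos s).
destruct (Hr (exp s) Hx (Hbc s Hs)) as (Dr & Hp & Hq & DA).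
assert (Hrp : 0 < r (exp s)).
{ replace (r (exp s)) with (r (exp s) / exp s * exp s) by (field; lra). now apply Rmult_lt_0_compat. }
split; [|split].
- unfold stretch_ratio. now apply Rdiv_lt_0_compat.
- unfold log_stretch, stretch_ratio. auto_derive.
  + repeat split; trivial; lra.
  + change (Derive (fun x => r x) (exp s)) with (Derive r (exp s)). field. lra.
- set (A := fun y => y ^ (n - 1) * Phi_d n kappa h 1 r y).
  match type of DA with is_derive _ _ ?l => change (is_derive A (exp s) l) in DA end.
  apply (is_derive_ext_loc (fun u => A (exp u) / (kappa * r (exp u) ^ m))).
  + generalize (locally_lt s b Hs). apply filter_imp. intros u Hu.
    destruct (Hr (exp u) (exp_pos u) (Hbc u Hu)) as (_ & Hp' & Hq' & _).
    unfold A. rewrite Phi_d_1 by assumption. fold (stretch_ratio r u). fold (log_stretch r u).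
    set (S := stress _ _ _ _). assert (Hy := exp_pos u).
    assert (Hrp' : r (exp u) <> 0) by (intros E; rewrite E in Hq'; unfold Rdiv in Hq'; lra).
    unfold m in *. destruct n_23 as [-> | ->]; simpl; field; repeat split; lra.
  + assert (EA : A (exp s) = kappa * r (exp s) ^ m * stress m compress (stretch_ratio r s) (log_stretch r s)).
    { unfold A. rewrite Phi_d_1 by assumption. fold (stretch_ratio r s). fold (log_stretch r s).
      set (S := stress _ _ _ _). unfold m in *. destruct n_23 as [-> | ->]; simpl; field; lra. }
    clearbody A. rewrite Phi_d_2 in DA by assumption. fold (stretch_ratio r s) in DA. fold (log_stretch r s) in DA.
    set (S := stress m compress (stretch_ratio r s) (log_stretch r s)) in *.
    assert (Eg := growth_eq m pred_n_12 (stretch_ratio r s)).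
    replace (INR m * ((1 - stretch_ratio r s) * growth m (stretch_ratio r s)))
      with (INR m * (stretch_ratio r s * (1 - stretch_ratio r s ^ m))) by (now rewrite Eg).
    assert (Et : stretch_ratio r s = Derive r (exp s) * exp s / r (exp s)) by (unfold stretch_ratio; field; lra).
    auto_derive.
    * repeat match goal with |- _ /\ _ => split end; trivial.
      -- exact (ex_intro _ _ DA).
      -- apply Rmult_integral_contrapositive_currified; [lra|]. apply pow_nonzero. lra.
    * rewrite (Derive_eta _ _ _ DA). rewrite EA.
      change (Derive (fun x => r x) (exp s)) with (Derive r (exp s)).
      rewrite Et. clear Et Eg EA DA. generalize S. intros S'.
      unfold m in *. destruct n_23 as [-> | ->]; simpl; field; lra.
Qed.

Lemma stress_free_cavity_log (c : R) (r : R -> R) :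
  0 < c -> (forall x, 0 < x < c -> 0 < Derive r x /\ 0 < r x / x) ->
  stress_free_cavity n kappa h r -> stress_free m compress (log_stretch r) (stretch_ratio r).
Proof.
intros Hc Hpos Hfree eps Heps.
assert (Hke : 0 < kappa * eps) by (now apply Rmult_lt_0_compat).
destruct (Hfree (ball 0 (mkposreal _ Hke)) (locally_ball _ _)) as [d Hd].
assert (Hm : 0 < Rmin d c) by (apply Rmin_glb_lt; [apply cond_pos|assumption]).
exists (ln (Rmin d c)). intros s Hs.
assert (Hx : exp s < Rmin d c).
{ rewrite <- (exp_ln (Rmin d c)) by assumption. now apply exp_increasing. }
assert (Hx0 := exp_pos s). assert (K1 := Rmin_l d c). assert (K2 := Rmin_r d c).
destruct (Hpos (exp s)) as (Hp & Hq); [lra|].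
assert (Hb : ball 0 (kappa * eps) (cauchy_stress n kappa h r (exp s))).
{ apply (Hd (exp s)); [|assumption]. unfold ball; simpl; unfold AbsRing_ball, abs, minus, plus, opp; simpl.
  apply Rabs_def1; lra. }
unfold ball in Hb; simpl in Hb; unfold AbsRing_ball, abs, minus, plus, opp in Hb; simpl in Hb.
rewrite cauchy_stress_eq, Ropp_0, Rplus_0_r, Rabs_mult, (Rabs_pos_eq kappa) in Hb by (trivial; lra).
fold (stretch_ratio r s) in Hb. fold (log_stretch r s) in Hb.
now apply Rmult_lt_reg_l in Hb.
Qed.

(** * From trajectories back to radial profiles *)

Definition profile (w : R -> R) (x : R) : R := x * exp (w (ln x)).

Lemma profile_derive (w t : R -> R) (x : R) : 0 < x -> (forall b, traj m compress b w t) ->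
  is_derive (profile w) x (exp (w (ln x)) * t (ln x)).
Proof.
intros Hx Htr. destruct (Htr (ln x + 1) (ln x)) as (_ & Dw & _); [lra|].
unfold profile. auto_derive.
- split; [now exists (t (ln x) - 1)|]. split; trivial.
- rewrite (Derive_eta _ _ _ Dw). field. lra.
Qed.

Lemma profile_ratio (w : R -> R) (x : R) : 0 < x -> profile w x / x = exp (w (ln x)).
Proof. intros Hx. unfold profile. field. lra. Qed.

Lemma profile_log_stretch (r : R -> R) (x : R) : 0 < x -> 0 < r x / x -> profile (log_stretch r) x = r x.
Proof.
intros Hx Hq. unfold profile, log_stretch. rewrite (exp_ln x), exp_ln by assumption. field. lra.
Qed.

Lemma profile_radial_solution (w t : R -> R) : (forall b, traj m compress b w t) ->
  radial_solution n kappa h p_infty (profile w).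
Proof.
intros Htr x Hx _.
assert (D := fun y Hy => profile_derive w t y Hy Htr).
assert (Hpos : forall y, 0 < y -> 0 < t (ln y)) by (intros y Hy; apply (Htr (ln y + 1)); lra).
assert (Hd : forall y, 0 < y -> Derive (profile w) y = exp (w (ln y)) * t (ln y)).
{ intros y Hy. now apply is_derive_unique, D. }
assert (Hdp : forall y, 0 < y -> 0 < Derive (profile w) y).
{ intros y Hy. rewrite Hd by assumption. apply Rmult_lt_0_compat; [apply exp_pos|now apply Hpos]. }
assert (Hqp : forall y, 0 < y -> 0 < profile w y / y).
{ intros y Hy. rewrite profile_ratio by assumption. apply exp_pos. }
assert (Hratio : forall y, 0 < y -> Derive (profile w) y / (profile w y / y) = t (ln y)).
{ intros y Hy. rewrite Hd, profile_ratio by assumption. field. generalize (exp_pos (w (ln y))). lra. }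
split; [eexists; now apply D|]. split; [now apply Hdp|]. split; [now apply Hqp|].
rewrite Phi_d_2, Hratio, Hd, profile_ratio, ln_exp by auto.
destruct (Htr (ln x + 1) (ln x)) as (Ht & Dw & DS); [lra|].
rewrite growth_eq in DS by exact pred_n_12.
apply (is_derive_ext_loc (fun y => y ^ (n - 1) * (kappa * exp (w (ln y)) ^ m * stress m compress (t (ln y)) (w (ln y))))).
{ generalize (locally_gt x 0 Hx). apply filter_imp. intros y Hy.
  now rewrite Phi_d_1, Hratio, profile_ratio, ln_exp by auto. }
set (S := fun s => stress m compress (t s) (w s)).
match type of DS with is_derive _ _ ?l => change (is_derive S (ln x) l) in DS end.
change (stress m compress (t (ln x)) (w (ln x))) with (S (ln x)).
change (is_derive (fun y => y ^ (n - 1) * (kappa * exp (w (ln y)) ^ m * S (ln y))) x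
  ((INR n - 1) * x ^ (n - 2) * (kappa * (exp (w (ln x)) * t (ln x)) * exp (w (ln x)) ^ (n - 2) * (S (ln x) - t (ln x) ^ m + 1)))).
auto_derive.
- repeat match goal with |- _ /\ _ => split end; trivial; eexists; eassumption.
- rewrite (Derive_eta _ _ _ Dw), (Derive_eta _ _ _ DS). generalize (S (ln x)). intros S'.
  unfold m in *. destruct n_23 as [-> | ->]; simpl; field; lra.
Qed.

Lemma profile_dilation (w : R -> R) (c x : R) : 0 < x ->
  profile w (exp c * x) / exp c = x * exp (w (ln x + c)).
Proof.
intros Hx. assert (Hc := exp_pos c). unfold profile.
rewrite ln_mult, ln_exp by assumption. rewrite (Rplus_comm c). field. lra.
Qed.


Hypothesis natural : partial 1 (Phi n kappa h) (fun _ => 1) = 0.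

(** The second alternative is the identity deformation, which is stress free. Stating the dichotomy
    without [cavitating] serves the last claim of the theorem, where [rl] is only known to be stress
    free at the centre. *)
Lemma radial_solution_cavity (c : Rbar) (b : R) (r : R -> R) :
  radial_solution n kappa h c r -> (forall s, s < b -> Rbar_lt (exp s) c) ->
  stress_free_cavity n kappa h r ->
  cavity m compress b (log_stretch r) (stretch_ratio r) \/ forall s, s < b -> log_stretch r s = 0.
Proof.
intros Hr Hbc Hfree.
assert (Htr := radial_solution_traj c b r Hr Hbc).
assert (Hsf : stress_free m compress (log_stretch r) (stretch_ratio r)).
{ apply (stress_free_cavity_log (exp b)); [apply exp_pos| |assumption].
  intros x Hx. assert (Hxc : Rbar_lt x c).
  { rewrite <- (exp_ln x) by tauto. apply Hbc. rewrite <- (ln_exp b). apply ln_increasing; tauto. }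
  destruct (Hr x (proj1 Hx) Hxc) as (_ & Hp & Hq & _). now split. }
destruct (stress_free_tangential m pred_n_12 compress dcompress compress_derive dcompress_pos b _ _ Htr Hsf (stress_natural natural)) as [H1|H0].
- left. exact (conj (conj Htr H1) Hsf).
- now right.
Qed.

Lemma log_stretch_0 (r : R -> R) (x : R) :
  0 < x -> 0 < r x / x -> log_stretch r (ln x) = 0 -> r x = x.
Proof.
intros Hx Hq E. rewrite <- (profile_log_stretch r x Hx Hq). unfold profile.
rewrite E, exp_0. ring.
Qed.

(** The identity deformation tends to 0 at the centre and so opens no cavity; at a small enough
    [x <= r0 / 2] this contradicts the limit [r0 > 0]. *)
Lemma cavitating_cavity (c : Rbar) (b : R) (r : R -> R) :
  radial_solution n kappa h c r -> (forall s, s < b -> Rbar_lt (exp s) c) ->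
  stress_free_cavity n kappa h r -> cavitating r ->
  cavity m compress b (log_stretch r) (stretch_ratio r).
Proof.
intros Hr Hbc Hfree (r0 & Hr0 & Hlim).
destruct (radial_solution_cavity c b r Hr Hbc Hfree) as [|H0]; [assumption|exfalso].
assert (Hr2 : 0 < r0 / 2) by lra.
destruct (Hlim (ball r0 (mkposreal _ Hr2)) (locally_ball _ _)) as [d Hd].
assert (K1 := Rmin_l (d / 2) (Rmin (exp b / 2) (r0 / 2))).
assert (K2 := Rle_trans _ _ _ (Rmin_r (d / 2) (Rmin (exp b / 2) (r0 / 2))) (Rmin_l _ _)).
assert (K3 := Rle_trans _ _ _ (Rmin_r (d / 2) (Rmin (exp b / 2) (r0 / 2))) (Rmin_r _ _)).
assert (Hd0 := cond_pos d). assert (Hb := exp_pos b).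
set (x := Rmin (d / 2) (Rmin (exp b / 2) (r0 / 2))) in *.
assert (Hx : 0 < x) by (repeat apply Rmin_glb_lt; lra).
assert (Hxb : ln x < b) by (rewrite <- (ln_exp b); apply ln_increasing; lra).
assert (Hxc := Hbc (ln x) Hxb). rewrite exp_ln in Hxc by assumption.
destruct (Hr x Hx Hxc) as (_ & _ & Hq & _).
assert (E := log_stretch_0 r x Hx Hq (H0 _ Hxb)).
assert (Hball : ball r0 (r0 / 2) (r x)).
{ apply (Hd x); [|assumption]. unfold ball; simpl; unfold AbsRing_ball, abs, minus, plus, opp; simpl.
  apply Rabs_def1; lra. }
rewrite E in Hball. unfold ball in Hball; simpl in Hball.
unfold AbsRing_ball, abs, minus, plus, opp in Hball; simpl in Hball. apply Rabs_def2 in Hball. lra.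
Qed.

End Radial.

(** * Limits at infinity, boundary values, and the theorem *)

Lemma exp_lt_1 (s : R) : s < 0 -> Rbar_lt (exp s) 1.
Proof. intros Hs. simpl. rewrite <- exp_0. now apply exp_increasing. Qed.

Lemma ln_lt_0 (x : R) : 0 < x < 1 -> ln x < 0.
Proof. intros Hx. rewrite <- ln_1. now apply ln_increasing. Qed.

Lemma stress_free_ext (m : nat) (k w t w' t' : R -> R) :
  (forall s, s < 0 -> w' s = w s /\ t' s = t s) -> stress_free m k w t -> stress_free m k w' t'.
Proof.
intros He Hf eps Heps. destruct (Hf eps Heps) as (s0 & Hs0).
exists (Rmin s0 0). intros s Hs. assert (K1 := Rmin_l s0 0). assert (K2 := Rmin_r s0 0).
destruct (He s) as [-> ->]; [lra|]. apply Hs0. lra.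
Qed.

Lemma is_lim_profile (w t : R -> R) (l : R) :
  (forall s, l < w s) -> (forall s, t s < 1) ->
  (forall eps, 0 < eps -> exists s0, forall s, s0 < s -> w s < l + eps) ->
  (forall eps, 0 < eps -> exists s0, forall s, s0 < s -> 1 - eps < t s) ->
  is_lim (fun x => exp (w (ln x))) p_infty (exp l) /\
  is_lim (fun x => exp (w (ln x)) * t (ln x)) p_infty (exp l).
Proof.
intros Hw Ht Lw Lt.
assert (Dw : is_lim w p_infty l).
{ apply is_lim_spec. intros eps. destruct (Lw eps (cond_pos eps)) as (s0 & Hs0).
  exists s0. intros s Hs. specialize (Hs0 s Hs). specialize (Hw s). apply Rabs_def1; lra. }
assert (Dt : is_lim t p_infty 1).
{ apply is_lim_spec. intros eps. destruct (Lt eps (cond_pos eps)) as (s0 & Hs0).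
  exists s0. intros s Hs. specialize (Hs0 s Hs). specialize (Ht s).
  assert (He := cond_pos eps). apply Rabs_def1; lra. }
assert (Hexp : is_lim (fun s => exp (w s)) p_infty (exp l)).
{ apply (filterlim_comp _ _ _ w exp _ (locally l)); [exact Dw|]. apply continuous_exp. }
assert (Hprod : is_lim (fun s => exp (w s) * t s) p_infty (exp l)).
{ rewrite <- (Rmult_1_r (exp l)). exact (is_lim_mult _ _ _ _ _ Hexp Dt I). }
split.
- exact (filterlim_comp _ _ _ ln (fun s => exp (w s)) _ _ _ is_lim_ln_p Hexp).
- exact (filterlim_comp _ _ _ ln (fun s => exp (w s) * t s) _ _ _ is_lim_ln_p Hprod).
Qed.

(** A solution on [(0, 1)] is not constrained at 1 by the equation; its boundary value is identified
    through the limit from the left. *)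
Lemma at_left_1_unique (f g : R -> R) (l : R) :
  (forall x, 0 < x < 1 -> f x = g x) -> filterlim f (at_left 1) (locally l) -> continuous g 1 -> l = g 1.
Proof.
intros He Hf Hg.
apply (filterlim_locally_unique (K := R_AbsRing) (V := R_NormedModule) (F := at_left 1) f); [assumption|].
apply (filterlim_ext_loc g).
- exists (mkposreal 1 Rlt_0_1). intros x Hx Hx1. symmetry. apply He.
  unfold ball in Hx; simpl in Hx; unfold AbsRing_ball, abs, minus, plus, opp in Hx; simpl in Hx.
  apply Rabs_def2 in Hx. lra.
- intros P HP. specialize (Hg P HP). unfold filtermap, at_left, within in *.
  revert Hg. apply filter_imp. intros x Hx _. exact Hx.
Qed.

Theorem proposition3p6 (n : nat) (kappa : R) (h : R -> R) (r : R -> R)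
    (hn : n = 2%nat \/ n = 3%nat) (hkappa : 0 < kappa)
    (hh : compressibility h)
    (hr_sol : radial_solution n kappa h 1 r)
    (hr_cav : cavitating r)
    (hr_free : stress_free_cavity n kappa h r)
    (h_natural : partial 1 (Phi n kappa h) (fun _ => 1) = 0) :
  exists rc : R -> R,
    (* rc extends r as a solution *)
    (forall x, 0 < x < 1 -> rc x = r x) /\
    radial_solution n kappa h p_infty rc /\
    (forall x, 0 < x -> Derive rc x < rc x / x) /\
    (* uniqueness of the extension *)
    (forall s : R -> R,
        (forall x, 0 < x < 1 -> s x = r x) ->
        radial_solution n kappa h p_infty s ->
        forall x, 0 < x -> s x = rc x) /\
    (* independence of r(1): all extended cavitating solutions agree up to
       the scaling invariance of the equation *)
    (forall s : R -> R,
        radial_solution n kappa h p_infty s ->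
        cavitating s ->
        stress_free_cavity n kappa h s ->
        exists alpha : R, 0 < alpha /\
          forall x, 0 < x -> s x = rc (alpha * x) / alpha) /\
    (exists lambda_c : R, 1 < lambda_c /\
      is_lim (Derive rc) p_infty lambda_c /\
      is_lim (fun x => rc x / x) p_infty lambda_c /\
      (forall (lambda : R) (rl : R -> R),
          lambda_c < lambda ->
          radial_solution n kappa h 1 rl ->
          stress_free_cavity n kappa h rl ->
          filterlim rl (at_left 1) (locally (rl 1)) ->
          rl 1 = lambda ->
          exists alpha : R,
            unique (fun a => 0 < a /\ rc a / a = lambda) alpha /\
            forall x, 0 < x <= 1 -> rl x = rc (alpha * x) / alpha)).
Proof.
set (m := (n - 1)%nat). set (k := compress n kappa h). set (dk := dcompress kappa h).
assert (Hm : m = 1%nat \/ m = 2%nat) by exact (pred_n_12 n hn).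
assert (Hk : forall J, 0 < J -> is_derive k J (dk J)) by exact (compress_derive n kappa h hkappa hh).
assert (Hdk : forall J, 0 < J -> 0 < dk J) by exact (dcompress_pos kappa h hkappa hh).
assert (Hnat : stress m k 1 0 = 0) by exact (stress_natural n hn kappa h hkappa hh h_natural).
assert (Cr : cavity m k 0 (log_stretch r) (stretch_ratio r))
  by exact (cavitating_cavity n hn kappa h hkappa hh h_natural 1 0 r hr_sol exp_lt_1 hr_free hr_cav).
destruct (tangential_extension m Hm k dk Hk Hdk 0 _ _ (proj1 Cr)) as (w & t & Hw & Hext).
assert (C : forall b, cavity m k b w t).
{ intros b. split; [apply Hw|]. exact (stress_free_ext m k _ _ _ _ Hext (proj2 Cr)). }
assert (Htr : forall b, traj m k b w t) by (intros b; apply Hw).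
assert (Ht1 : forall s, t s < 1) by (intros s; apply (proj2 (Hw (s + 1))); lra).
assert (Dprof : forall x, 0 < x -> Derive (profile w) x = exp (w (ln x)) * t (ln x)).
{ intros x Hx. apply is_derive_unique. exact (profile_derive n kappa h w t x Hx Htr). }
assert (Hinj : forall s u, w s = w u -> s = u).
{ intros s u E. apply (tangential_w_inj m k (Rmax s u + 1) w t); [apply Hw| | |assumption].
  - generalize (Rmax_l s u). lra. - generalize (Rmax_r s u). lra. }
assert (Hrpos : forall x, 0 < x < 1 -> 0 < r x / x).
{ intros x Hx. apply (hr_sol x); [tauto|exact (proj2 Hx)]. }
assert (Hrc : forall x, 0 < x < 1 -> profile w x = r x).
{ intros x Hx. rewrite <- (profile_log_stretch r x (proj1 Hx) (Hrpos x Hx)).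
  unfold profile. now rewrite (proj1 (Hext (ln x) (ln_lt_0 x Hx))). }
destruct (cavity_limit m Hm k dk Hk Hdk w t C Hnat) as (l & Hl & Hlw & Lw & Lt).
exists (profile w). split; [assumption|]. split; [|split; [|split; [|split]]].
- exact (profile_radial_solution n hn kappa h hkappa hh w t Htr).
- intros x Hx. rewrite Dprof, profile_ratio by assumption.
  assert (Hp := exp_pos (w (ln x))). specialize (Ht1 (ln x)). nra.
- intros s Hs Hsol x Hx.
  destruct (Rlt_le_dec x 1) as [Hx1|Hx1]; [rewrite Hrc, Hs by lra; reflexivity|].
  assert (Htrs : forall b, traj m k b (log_stretch s) (stretch_ratio s)).
  { intros b. apply (radial_solution_traj n hn kappa h hkappa hh p_infty b s Hsol). intros u _; exact I. }
  assert (Hneg : forall u, u < 0 -> log_stretch s u = w u /\ stretch_ratio s u = t u).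
  { intros u Hu. assert (Hu1 := exp_lt_1 u Hu). simpl in Hu1. assert (Hu0 := exp_pos u).
    destruct (Hext u Hu) as [-> ->]. unfold log_stretch, stretch_ratio.
    rewrite Hs by lra. split; [reflexivity|]. f_equal. apply Derive_ext_loc.
    generalize (filter_and _ _ (locally_gt (exp u) 0 Hu0) (locally_lt (exp u) 1 Hu1)).
    apply filter_imp. exact Hs. }
  (* Any negative time would serve as common starting point. There [t < 1] holds for [s] as well,
     and the constant sign of [1 - t] extends this to all times, so forward uniqueness applies. *)
  destruct (Hneg (-1)) as [E1 E2]; [lra|].
  assert (Hlnx : 0 <= ln x) by (rewrite <- ln_1; destruct Hx1 as [Hx1| <-]; [left; apply ln_increasing|]; lra).
  destruct (tangential_forward_unique m Hm k dk Hk Hdk (ln x + 1) (ln x + 1)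
    (log_stretch s) (stretch_ratio s) w t (-1) (ln x)) as [E _]; try assumption; try lra.
  + split; [apply Htrs|]. intros u Hu.
    apply (traj_t_side m Hm k dk Hk Hdk (ln x + 1) (log_stretch s) _ (-1) u (Htrs _)); [lra|assumption|].
    rewrite E2. apply Ht1.
  + apply Hw.
  + destruct (Hsol x Hx I) as (_ & _ & Hq & _).
    rewrite <- (profile_log_stretch s x Hx Hq). unfold profile. now rewrite E.
- intros s Hsol Hcav Hfree.
  assert (Cs : forall b, cavity m k b (log_stretch s) (stretch_ratio s)).
  { intros b. apply (cavitating_cavity n hn kappa h hkappa hh h_natural p_infty b s); try assumption.
    intros u _; exact I. }
  destruct (cavity_unique m Hm k dk Hk Hdk 0 _ _ w t (Cs 0) C) as (c & Hc).
  (* Each horizon yields its own translation [c']; comparing at time -1, injectivity of [w]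
     identifies it with [c]. *)
  assert (Hcall : forall u, log_stretch s u = w (u + c)).
  { intros u. destruct (cavity_unique m Hm k dk Hk Hdk (Rmax 0 u + 1) _ _ w t (Cs _) C) as (c' & Hc').
    assert (K1 := Rmax_l 0 u). assert (K2 := Rmax_r 0 u).
    assert (E : -1 + c = -1 + c') by (apply Hinj; rewrite <- Hc, <- Hc' by lra; reflexivity).
    replace c with c' by lra. apply Hc'. lra. }
  exists (exp c). split; [apply exp_pos|]. intros x Hx.
  destruct (Hsol x Hx I) as (_ & _ & Hq & _).
  rewrite profile_dilation, <- Hcall by assumption.
  symmetry. now apply profile_log_stretch.
- exists (exp l).
  destruct (is_lim_profile w t l Hlw Ht1 Lw Lt) as [L1 L2].
  assert (Hl1 : 1 < exp l) by (rewrite <- exp_0; now apply exp_increasing).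
  split; [assumption|]. split; [|split].
  + apply (is_lim_ext_loc (fun x => exp (w (ln x)) * t (ln x))); [|assumption].
    exists 0. intros x Hx. symmetry. now apply Dprof.
  + apply (is_lim_ext_loc (fun x => exp (w (ln x)))); [|assumption].
    exists 0. intros x Hx. symmetry. now apply profile_ratio.
  + intros lambda rl Hlam Hsol Hfree Hleft Hval.
    assert (Hpos : forall x, 0 < x < 1 -> 0 < rl x / x).
    { intros x Hx. apply (Hsol x); [tauto|exact (proj2 Hx)]. }
    destruct (radial_solution_cavity n hn kappa h hkappa hh h_natural 1 0 rl Hsol exp_lt_1 Hfree) as [Crl|H0].
    * destruct (cavity_unique m Hm k dk Hk Hdk 0 _ _ w t Crl C) as (c & Hc).
      assert (Hrl : forall x, 0 < x < 1 -> rl x = x * exp (w (ln x + c))).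
      { intros x Hx. rewrite <- Hc by now apply ln_lt_0. symmetry.
        apply profile_log_stretch; [tauto|now apply Hpos]. }
      assert (Hcont : continuous (fun x => x * exp (w (ln x + c))) 1).
      { destruct (Htr (ln 1 + c + 1) (ln 1 + c)) as (_ & Dw & _); [lra|].
        apply (ex_derive_continuous (fun x => x * exp (w (ln x + c)))).
        auto_derive. split; [eexists; exact Dw|]. split; [lra|trivial]. }
      assert (Hrl1 := at_left_1_unique rl _ (rl 1) Hrl Hleft Hcont). simpl in Hrl1.
      (* At [x = 1] the translation formula reads [lambda = exp (w c)], which is the ratio
         [rc a / a] at [a = exp c]; injectivity of [w] makes this [a] unique. *)
      exists (exp c). split.
      -- split.
         ++ split; [apply exp_pos|]. rewrite profile_ratio, ln_exp by apply exp_pos.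
            rewrite <- Hval, Hrl1, ln_1. rewrite Rplus_0_l. ring.
         ++ intros a (Ha & Ea). rewrite profile_ratio in Ea by assumption.
            rewrite <- Hval, Hrl1, ln_1, Rplus_0_l, Rmult_1_l in Ea.
            apply exp_inv, Hinj in Ea. rewrite <- Ea. now apply exp_ln.
      -- intros x Hx. rewrite profile_dilation by tauto.
         destruct (Req_dec x 1) as [->|Hn]; [assumption|]. apply Hrl. lra.
    (* The identity has boundary value 1, whereas [lambda] exceeds [exp l > 1]. *)
    * exfalso. assert (Hid : forall x, 0 < x < 1 -> rl x = (fun x => x) x).
      { intros x Hx. apply log_stretch_0; [tauto|now apply Hpos|]. apply H0. now apply ln_lt_0. }
      assert (E := at_left_1_unique rl _ (rl 1) Hid Hleft (continuous_id 1)). simpl in E. lra.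
Qed.
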